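(* Let $S,T\in\mathrm{Dom}^{\mathrm{loc}}(\mathrm{Li})$. Then $$S\sqcup\!\sqcup T\in\mathrm{Dom}^{\mathrm{loc}}(\mathrm{Li}),\qquad \pi_X\big(\pi_Y(S)\ast\pi_Y(T)\big)\in\mathrm{Dom}^{\mathrm{loc}}(\mathrm{Li}),$$ and, for all $N\ge0$ (the function identities being identities of analytic functions near $0$, equivalently of Taylor series at $0$), $$\mathrm{Li}_{S\sqcup\!\sqcup T}=\mathrm{Li}_S\,\mathrm{Li}_T,\qquad \mathrm{Li}_{1_{X^*}}=1,$$ $$\mathrm{H}_{\pi_Y(S)\ast\pi_Y(T)}(N)=\mathrm{H}_{\pi_Y(S)}(N)\,\mathrm{H}_{\pi_Y(T)}(N),$$ $$\frac{\mathrm{Li}_S(z)}{1-z}\odot\frac{\mathrm{Li}_T(z)}{1-z}=\frac{\mathrm{Li}_{\pi_X(\pi_Y(S)\ast\pi_Y(T))}(z)}{1-z}.$$ Here $\ast$ denotes the stuffle product and $\odot$ the Hadamard product.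
   Context: Let $X=\{x_0,x_1\}$, $Y=\{y_n\}_{n\ge1}$, with free monoids $X^*,Y^*$; $\mathbb{C}\langle\!\langle X\rangle\!\rangle$, $\mathbb{C}\langle\!\langle Y\rangle\!\rangle$ are the spaces of noncommutative series; $\langle S\mid w\rangle$ is the coefficient of $w$ in $S$; for $S\in\mathbb{C}\langle\!\langle X\rangle\!\rangle$, $[S]_n=\sum_{|w|=n}\langle S\mid w\rangle w$ with $|w|$ the length. $\mathbb{C}\langle\!\langle X\rangle\!\rangle x_1\oplus\mathbb{C}1_{X^*}$ is the set of series supported on words ending in $x_1$ together with the empty word. Shuffle $\sqcup\!\sqcup$: $u\sqcup\!\sqcup 1=1\sqcup\!\sqcup u=u$, $au\sqcup\!\sqcup bv=a(u\sqcup\!\sqcup bv)+b(au\sqcup\!\sqcup v)$ for letters $a,b$ and words $u,v$ over $X$. Stuffle $\ast$ (over $Y$): $u\ast 1=1\ast u=u$, $y_su\ast y_tv=y_s(u\ast y_tv)+y_t(y_su\ast v)+y_{s+t}(u\ast v)$. Both extend bilinearly to polynomials and to series. Hadamard product: $\big(\sum_N a_Nz^N\big)\odot\big(\sum_N b_Nz^N\big)=\sum_N a_Nb_Nz^N$. For $w=x_0^{s_1-1}x_1\cdots x_0^{s_r-1}x_1$ ($r,s_i\ge1$) and $|z|<1$, $\mathrm{Li}_w(z)=\sum_{n_1>\cdots>n_r>0}\frac{z^{n_1}}{n_1^{s_1}\cdots n_r^{s_r}}$; $\mathrm{Li}_{1_{X^*}}=1$; extended linearly to polynomials. $\pi_Y:\mathbb{C}\langle\!\langle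 X\rangle\!\rangle x_1\oplus\mathbb{C}1_{X^*}\to\mathbb{C}\langle\!\langle Y\rangle\!\rangle$ is the linear bijection (acting word by word) sending $x_0^{s_1-1}x_1\cdots x_0^{s_r-1}x_1\mapsto y_{s_1}\cdots y_{s_r}$, $1_{X^*}\mapsto1_{Y^*}$; $\pi_X$ is its inverse. $D_{<R}=\{|z|<R\}$; $\mathcal{H}(D_{<R})$ is the space of holomorphic functions on it with the topology of uniform convergence on compact sets (unconditional convergence of $\sum f_n$ being equivalent to $\sum_n\sup_K|f_n|<+\infty$ for every compact $K$). For $0<R\le1$, $\mathrm{Dom}_R(\mathrm{Li})$ is the set of $S\in\mathbb{C}\langle\!\langle X\rangle\!\rangle x_1\oplus\mathbb{C}1_{X^*}$ such that $\sum_{n\ge0}\mathrm{Li}_{[S]_n}$ is unconditionally convergent in $\mathcal{H}(D_{<R})$, and $\mathrm{Dom}^{\mathrm{loc}}(\mathrm{Li})=\bigcup_{0<R\le1}\mathrm{Dom}_R(\mathrm{Li})$. For $S\in\mathrm{Dom}^{\mathrm{loc}}(\mathrm{Li})$, near $0$, $\mathrm{Li}_S(z)=\sum_{n\ge0}\mathrm{Li}_{[S]_n}(z)$, and the numbers $\mathrm{H}_{\pi_Y(S)}(N)$ are defined by $\frac{\mathrm{Li}_S(z)}{1-z}=\sum_{N\ge0}\mathrm{H}_{\pi_Y(S)}(N)z^N$. *)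

(* Defs.v *)
From HB Require Import structures.
From mathcomp Require Import all_boot all_order all_algebra finmap.
From mathcomp Require Import complex.
From mathcomp Require Import all_classical all_reals all_analysis.
From mathcomp.analysis.showcase Require Import summability.

Set Implicit Arguments.
Unset Strict Implicit.
Unset Printing Implicit Defensive.

Import Order.TTheory GRing.Theory Num.Theory.
Import numFieldNormedType.Exports.

Local Open Scope classical_set_scope.
Local Open Scope ring_scope.
Local Open Scope complex_scope.

(* The norm topology of the numFieldType R[i], seen as a normed module over
   itself. *)
HB.instance Definition _ (R : realType) := NormedModule.copy R[i] R[i]^o.

(* A word over an alphabet A is a [seq A].  The letters of X = {x_0, x_1} are
   booleans; a letter y_s (s >= 1) of Y is encoded by the natural number
   s - 1, so that the number k stands for y_(k+1). *)
Definition x0 : bool := false.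
Definition x1 : bool := true.

Definition ncseries (R : realType) (A : Type) := seq A -> R[i].

(* The shuffle of two words, as a list of words with multiplicities. *)
Fixpoint shuffle (A : Type) (u : seq A) : seq A -> seq (seq A) :=
  fix shuffle_u (v : seq A) : seq (seq A) :=
    match u, v with
    | [::], _ => [:: v]
    | _, [::] => [:: u]
    | a :: u', b :: v' =>
        [seq a :: w | w <- shuffle u' v] ++ [seq b :: w | w <- shuffle_u v']
    end.

(* The stuffle of two words over Y, as a list of words with multiplicities.
   With y_s and y_t encoded by j = s - 1 and k = t - 1, the letter y_(s+t) is
   encoded by j + k + 1. *)
Fixpoint stuffle (u : seq nat) : seq nat -> seq (seq nat) :=
  fix stuffle_u (v : seq nat) : seq (seq nat) :=
    match u, v with
    | [::], _ => [:: v]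
    | _, [::] => [:: u]
    | j :: u', k :: v' =>
        [seq j :: w | w <- stuffle u' v] ++ [seq k :: w | w <- stuffle_u v']
        ++ [seq (j + k).+1 :: w | w <- stuffle u' v']
    end.

Lemma shuffle_size (A : eqType) (u v w : seq A) :
  w \in shuffle u v -> size w = (size u + size v)%N.
Proof.
elim: u v w => [|a u IHu] v w; first by case: v => [|b v]; rewrite inE => /eqP->.
elim: v w => [|b v IHv] w; first by rewrite inE => /eqP->; rewrite addn0.
rewrite mem_cat => /orP[] /mapP[w' hw' ->] /=.
  by rewrite (IHu _ _ hw') /= addSn.
by rewrite (IHv _ hw') /= addnS.
Qed.

Lemma stuffle_weight (u v w : seq nat) :
  w \in stuffle u v ->
  sumn (map succn w) = (sumn (map succn u) + sumn (map succn v))%N.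
Proof.
elim: u v w => [|j u IHu] v w; first by case: v => [|k v]; rewrite inE => /eqP->.
elim: v w => [|k v IHv] w; first by rewrite inE => /eqP->; rewrite addn0.
rewrite !mem_cat => /or3P[] /mapP[w' hw' ->] /=.
- by rewrite (IHu _ _ hw') /= !addSn addnA.
- by rewrite (IHv _ hw') /= addnCA.
- by rewrite (IHu _ _ hw') addnACA addSn addnS.
Qed.

Definition words_le (A : finType) (n : nat) : seq (seq A) :=
  flatten [seq [seq val t | t <- enum {: m.-tuple A}] | m <- iota 0 n.+1].

Lemma mem_words_le (A : finType) n (u : seq A) :
  (size u <= n)%N -> u \in words_le A n.
Proof.
move=> un; apply/flatten_mapP; exists (size u).
  by rewrite mem_iota /= add0n ltnS.
by apply/mapP; exists (in_tuple u); rewrite ?mem_enum.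
Qed.

(* A word w occurs in finitely many shuffles (resp. stuffles) u, v, so that
   the finitely supported sums in [bilinear_ext] below are genuine. *)
Lemma finite_shuffle (w : seq bool) :
  finite_set [set p : seq bool * seq bool | w \in shuffle p.1 p.2].
Proof.
pose W : set (seq bool) := [set` words_le bool (size w)].
apply: (@sub_finite_set _ _ (W `*` W)); last first.
  by apply: finite_setX; exact: finite_seq.
move=> -[u v] /= /shuffle_size e.
by split; apply: mem_words_le; rewrite /= e ?leq_addr ?leq_addl.
Qed.

Lemma finite_stuffle (w : seq nat) :
  finite_set [set p : seq nat * seq nat | w \in stuffle p.1 p.2].
Proof.
set n := sumn (map succn w).
pose W : set (seq nat) :=
  map (@nat_of_ord n.+1) @` [set` words_le 'I_n.+1 n].
apply: (@sub_finite_set _ _ (W `*` W)); last first.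
  by apply: finite_setX; apply: finite_image; exact: finite_seq.
have H (u : seq nat) : (sumn (map succn u) <= n)%N -> W u.
  move=> un; exists (map inord u) => /=.
    apply: mem_words_le; rewrite size_map; apply: leq_trans un.
    by elim: u => //= k u IH; rewrite addSn ltnS (leq_trans IH) ?leq_addl.
  rewrite -map_comp -[RHS]map_id; apply/eq_in_map => k ku /=.
  rewrite inordK // ltnS (leq_trans _ un) //.
  elim: u ku {un} => //= l u IH; rewrite inE => /orP[/eqP->|/IH h].
    by rewrite addSn ltnW // ltnS leq_addr.
  exact: leq_trans h (leq_addl _ _).
move=> -[u v] /= /stuffle_weight e; rewrite -/n in e.
by split; apply: H; rewrite /= e ?leq_addr ?leq_addl.
Qed.

Section Polylog.
Variable R : realType.
Local Notation C := R[i].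

(* Bilinear extension to series of a product of words given as lists. *)
Definition bilinear_ext (A : choiceType)
    (op : seq A -> seq A -> seq (seq A)) (S T : ncseries R A) :
    ncseries R A :=
  fun w => \sum_(p \in [set: seq A * seq A])
             S p.1 * T p.2 * (count_mem w (op p.1 p.2))%:R.

Definition shuffle_series : ncseries R bool -> ncseries R bool ->
    ncseries R bool := bilinear_ext (@shuffle bool).

Definition stuffle_series : ncseries R nat -> ncseries R nat ->
    ncseries R nat := bilinear_ext stuffle.

Definition one_series : ncseries R bool := fun w => (w == [::])%:R.

Definition admissible (w : seq bool) : bool :=
  (w == [::]) || (last x0 w == x1).

(* C<<X>> x_1 (+) C 1 *)
Definition admissible_series (S : ncseries R bool) : Prop :=
  forall w, ~~ admissible w -> S w = 0.

Definition xword_of (v : seq nat) : seq bool :=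
  flatten [seq rcons (nseq k x0) x1 | k <- v].

(* Inverse of [xword_of] on admissible words; [k] counts the letters x_0 read
   since the last x_1, and trailing x_0's are dropped. *)
Fixpoint yword_of_rec (k : nat) (w : seq bool) : seq nat :=
  match w with
  | [::] => [::]
  | a :: w' => if a == x1 then k :: yword_of_rec 0 w' else yword_of_rec k.+1 w'
  end.

Definition yword_of (w : seq bool) : seq nat := yword_of_rec 0 w.

Lemma xword_of_rec k w :
  admissible w -> (w == [::]) ==> (k == 0)%N ->
  xword_of (yword_of_rec k w) = nseq k x0 ++ w.
Proof.
elim: w k => [|[] w IHw] k; first by move=> _ /= /eqP->.
- move=> aw _; rewrite /= /xword_of /= -/(xword_of _) IHw ?cat_rcons //.
    by case: w aw {IHw}.
  by rewrite implybT.
- case: w IHw => // a w IHw aw _; rewrite [LHS](IHw k.+1) //=.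
  by elim: k => //= k ->.
Qed.

Lemma yword_ofK w : admissible w -> xword_of (yword_of w) = w.
Proof. by move=> aw; rewrite [LHS]xword_of_rec ?eqxx ?implybT. Qed.

Lemma xword_ofK : cancel xword_of yword_of.
Proof.
rewrite /yword_of; elim=> //= k v IHv; rewrite /xword_of /= -/(xword_of v).
rewrite cat_rcons -[in RHS](addn0 k); elim: k 0%N => [|k IHk] j /=.
  by rewrite IHv.
by rewrite IHk addnS.
Qed.

Definition piY (S : ncseries R bool) : ncseries R nat :=
  fun v => S (xword_of v).

Definition piX (V : ncseries R nat) : ncseries R bool :=
  fun w => if admissible w then V (yword_of w) else 0.

(* \sum_(M > n_1 > ... > n_r > 0) 1 / (n_1 ^ s_1 ... n_r ^ s_r) *)
Fixpoint harmonic_sum (v : seq nat) (M : nat) : C :=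
  match v with
  | [::] => 1
  | k :: v' => \sum_(1 <= n < M) harmonic_sum v' n / n%:R ^+ k.+1
  end.

(* \sum_(n_1 > ... > n_r > 0) z ^ n_1 / (n_1 ^ s_1 ... n_r ^ s_r), where n_1 is
   the outermost index. *)
Definition polylog (v : seq nat) (z : C) : C :=
  match v with
  | [::] => 1
  | k :: v' =>
      limn (fun M => \sum_(1 <= n < M) z ^+ n * harmonic_sum v' n / n%:R ^+ k.+1)
  end.

(* Li of the homogeneous part of degree n of S *)
Definition Li_part (S : ncseries R bool) (n : nat) (z : C) : C :=
  \sum_(w : n.-tuple bool | admissible w) S w * polylog (yword_of w) z.

Definition disc (r : R) : set C := [set z | `|z| < r%:C].

Definition holomorphic_on (D : set C) (f : C -> C) : Prop :=
  forall z, D z -> derivable f z 1.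

(* Convergence, to an element of H(D), of the net of the finite partial sums
   of the f_n, uniformly on the compact subsets of D. *)
Definition unconditionally_cvg (D : set C) (f : nat -> C -> C) : Prop :=
  exists2 g : C -> C, holomorphic_on D g &
    {family compactly_in D, partial_sum f @ totally --> g}.

Definition Dom (r : R) (S : ncseries R bool) : Prop :=
  admissible_series S /\ unconditionally_cvg (disc r) (Li_part S).

Definition Dom_loc (S : ncseries R bool) : Prop :=
  exists r : R, 0 < r <= 1 /\ Dom r S.

Definition Li (S : ncseries R bool) (z : C) : C :=
  limn (series (fun n => Li_part S n z)).

(* f(z) = \sum_N a_N z ^ N near 0 *)
Definition has_expansion (f : C -> C) (a : nat -> C) : Prop :=
  \forall z \near (0 : C), series (fun N => a N * z ^+ N) @ \oo --> f z.

(* The coefficients of the expansion of f at 0, when there is one (they are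
   then unique); 0 otherwise. *)
Definition taylor_coef (f : C -> C) : nat -> C :=
  xget (fun=> 0) [set a | has_expansion f a].

(* As piX is the inverse of piY, this is H_(pi_Y(S)) for V = pi_Y(S). *)
Definition H (V : ncseries R nat) (N : nat) : C :=
  taylor_coef (fun z => Li (piX V) z / (1 - z)) N.

(* f (.) g = h near 0, (.) being the Hadamard product; in particular f, g and
   h have expansions at 0. *)
Definition is_hadamard (f g h : C -> C) : Prop :=
  exists a b : nat -> C, [/\ has_expansion f a, has_expansion g b &
    has_expansion h (fun N => a N * b N)].

End Polylog.

(* Main.v *)
Require Import Defs.
From HB Require Import structures.
From mathcomp Require Import all_boot all_order all_algebra finmap.
From mathcomp Require Import complex.
From mathcomp Require Import all_classical all_reals all_analysis.
From mathcomp.analysis.showcase Require Import summability.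
From mathcomp Require Import cyclic separable cyclotomic.
From mathcomp Require Import ring lra zify.

(** The theorem is proved on Taylor coefficients at 0. The component of degree n
    of an admissible series S is a finite combination of words, so that its
    polylogarithm has coefficients [part_coef S n N]. A series belongs to
    Dom_loc(Li) if and only if it is admissible and, for some rho > 0, the sums
    over n of the moduli of [part_coef S n N] are bounded by a multiple of
    rho^-N, uniformly in N ([Dom_loc_coef_bounded], [coef_bounded_Dom_loc]).

    For the direct implication, unconditional uniform convergence on a compact
    set containing a circle bounds all finite sums of components whose degrees
    avoid a fixed finite set. Cauchy's estimate transfers this bound to the
    coefficient of z^N, with a constant independent of the set of degrees, and
    choosing the degrees by the signs of real and imaginary parts bounds the
    sums of moduli ([Dom_coef_bounded]). Conversely such a bound makes the double
    series in n and N absolutely convergent on a smaller disc, uniformly; its sum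
    is holomorphic and is a power series in z ([Li_series],
    [coef_bounded_Dom]).

    Both products respect the grading, by length for the shuffle and by weight
    for the stuffle, so the identities need only be known for words. There,
    polylogarithms multiply by the shuffle because they solve
    z Li_(x0 w)' = Li_w and z Li_(x1 w)' = z/(1-z) Li_w ([li_coef_shuffle]), and
    truncated harmonic sums multiply by the stuffle because a pair of outermost
    indices is ordered in one of three ways ([harmonic_sum_stuffle]). Hence the
    components of the product of two series are Cauchy products in n of the
    components of the factors, and the products of the coefficient bounds of the
    factors bound the coefficients of the product series on a smaller disc.
    Summing over n yields Li_S Li_T for the shuffle. For the stuffle it yields
    the product of the N-th coefficients of Li_S / (1 - z) and Li_T / (1 - z);
    by uniqueness of expansions these coefficients are the numbers H(N). *)

Set Implicit Arguments.
Unset Strict Implicit.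
Unset Printing Implicit Defensive.

Import Order.TTheory GRing.Theory Num.Theory.
Import numFieldNormedType.Exports.
Import Normc.

Local Open Scope classical_set_scope.
Local Open Scope ring_scope.
Local Open Scope complex_scope.

(** * Absolutely convergent complex series *)

Section ComplexSeries.
Variable R : realType.
Local Notation C := R[i].
Implicit Types (u v a : nat -> C) (z l : C).

Lemma normrcE z : `|z| = (normc z)%:C.
Proof. by []. Qed.

Lemma normc_ge0 z : 0 <= normc z.
Proof. by case: z => x y; exact: sqrtr_ge0. Qed.

Lemma normcX z n : normc (z ^+ n) = normc z ^+ n.
Proof. by elim: n => [|n IH]; rewrite ?expr0 ?normc1 // !exprS normcM IH. Qed.

Lemma normc_real (x : R) : normc x%:C = `|x|.
Proof. by rewrite /normc /= expr0n addr0 sqrtr_sqr. Qed.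

Lemma normc_nat n : normc (n%:R : C) = n%:R.
Proof. by rewrite -(rmorph_nat (real_complex R)) normc_real normr_nat. Qed.

Lemma ler_normc_sum (I : Type) (r : seq I) (P : pred I) (F : I -> C) :
  normc (\sum_(i <- r | P i) F i) <= \sum_(i <- r | P i) normc (F i).
Proof.
elim/big_ind2: _ => //; first by rewrite normc0.
by move=> x x' y y' h h'; apply: le_trans (le_normcD _ _) (lerD h h').
Qed.

Lemma normc_le_ReIm z : normc z <= `|complex.Re z| + `|complex.Im z|.
Proof.
rewrite [z in X in X <= _]complexE; apply: le_trans (le_normcD _ _) _.
rewrite normcM !normc_real (_ : normc 'i = 1) ?mul1r //.
by rewrite /normc expr0n expr1n add0r sqrtr1.
Qed.

Lemma abs_Re_le z : `|complex.Re z| <= normc z.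
Proof. by have := normc_ge_Re z; rewrite normrcE lecR. Qed.

Lemma abs_Im_le z : `|complex.Im z| <= normc z.
Proof. by case: z => x y /=; rewrite -sqrtr_sqr ler_wsqrtr // lerDr sqr_ge0. Qed.

(** The order of R[i] is partial, so limits are tested with the R-valued
    modulus, for which linear arithmetic is available. *)
Lemma cvgcP (T : Type) (F : set_system T) {FF : Filter F} (f : T -> C) l :
  f @ F --> l <-> forall e : R, 0 < e -> \forall t \near F, normc (l - f t) <= e.
Proof.
split=> [/cvgrPdist_le h e e0|h].
  have e0C : 0 < e%:C by rewrite ltcR.
  by have := h _ e0C; apply: filterS => t; rewrite normrcE lecR.
apply/cvgrPdist_le => e e0; have er : e \is Num.real by exact: gtr0_real.
have := h (complex.Re e); rewrite -ltcR RRe_real // => /(_ e0).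
by apply: filterS => t; rewrite normrcE -[in X in _ -> X](RRe_real er) lecR.
Qed.

Lemma cvgc_normc_le (T : Type) (F : set_system T) {FF : ProperFilter F}
    (f : T -> C) l B :
  f @ F --> l -> (\forall t \near F, normc (f t) <= B) -> normc l <= B.
Proof.
move=> /cvgcP fl fB; apply/ler_addgt0Pr => e /fl fe.
have [t [te tB]] := filter_ex (filterI fe fB).
by rewrite -(subrK (f t) l) addrC; apply: le_trans (le_normcD _ _) (lerD _ _).
Qed.

(** One rank serves all later starting points n, so that several tails can be
    controlled by taking the maximum of their ranks. *)
Lemma small_tail (b : nat -> R) B : (forall n, 0 <= b n) ->
    (forall n, \sum_(0 <= k < n) b k <= B) ->
  forall e, 0 < e ->
  exists n0, forall n m, (n0 <= n)%N -> \sum_(n <= k < m) b k <= e.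
Proof.
move=> b0 bB e e0.
have nd : nondecreasing_seq (series b) by exact: nondecreasing_series.
have /nondecreasing_cvgn/(_ _) cv : has_ubound (range (series b)).
  by exists B => _ [n _ <-]; exact: bB.
have {}cv := cv nd.
set l := sup _ in cv.
have le_l n : series b n <= l.
  by rewrite -(cvg_lim _ cv) //; apply: nondecreasing_cvgn_le => //; exact: cvgP cv.
have /cvgrPdist_le/(_ e e0)[n0 _ h] := cv.
exists n0 => n m n0n; have [mn|nm] := leqP m n; first by rewrite big_geq // ltW.
rewrite -sub_series_geq ?(ltnW nm) //.
have /= := h n n0n; rewrite ger0_norm => [{}h|]; last by rewrite subr_ge0 le_l.
by have := le_l m; lra.
Qed.

(** Completeness of C is obtained from that of R: the real and imaginary parts
    are absolutely convergent real series. *)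
Lemma abs_series_cvg u B : (forall n, \sum_(0 <= k < n) normc (u k) <= B) ->
  exists l, series u @ \oo --> l.
Proof.
move=> uB.
have key (p : C -> R) : (forall z, `|p z| <= normc z) ->
    cvgn (series (fun k => p (u k))).
  move=> pz; apply: normed_cvg; apply: nondecreasing_is_cvgn.
    by apply: nondecreasing_series => n _ _; exact: normr_ge0.
  exists B => _ [n _ <-]; apply: le_trans (uB n).
  by apply: ler_sum => k _; exact: pz.
have /cvg_ex[x /cvgrPdist_le hx] := key _ (@abs_Re_le).
have /cvg_ex[y /cvgrPdist_le hy] := key _ (@abs_Im_le).
exists (x +i* y); apply/cvgcP => e e0; have e2 : 0 < e / 2 by rewrite divr_gt0.
near=> n.
have ReE : complex.Re (series u n) = series (fun k => complex.Re (u k)) n.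
  by rewrite /series /=; apply: (big_morph (@complex.Re R)) => // -[? ?] [].
have ImE : complex.Im (series u n) = series (fun k => complex.Im (u k)) n.
  by rewrite /series /=; apply: (big_morph (@complex.Im R)) => // -[? ?] [].
apply: le_trans (normc_le_ReIm _) _; rewrite [leRHS]splitr.
have -> : complex.Re ((x +i* y) - series u n) =
    x - series (fun k => complex.Re (u k)) n by rewrite -ReE; case: (series u n).
have -> : complex.Im ((x +i* y) - series u n) =
    y - series (fun k => complex.Im (u k)) n by rewrite -ImE; case: (series u n).
by apply: lerD; near: n; [exact: hx|exact: hy].
Unshelve. all: by end_near.
Qed.

Lemma abs_series_le u l B : series u @ \oo --> l ->
  (forall n, \sum_(0 <= k < n) normc (u k) <= B) -> normc l <= B.
Proof.
move=> ul uB; apply: (cvgc_normc_le ul); near=> n.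
exact: le_trans (ler_normc_sum _ _ _) (uB n).
Unshelve. all: by end_near.
Qed.

Lemma cvgn_sum (K : numFieldType) (V : normedModType K) (I : Type) (r : seq I)
    (P : pred I) (F : I -> nat -> V) (G : I -> V) : (forall i, P i -> F i @ \oo --> G i) ->
  (fun n => \sum_(i <- r | P i) F i n) @ \oo --> \sum_(i <- r | P i) G i.
Proof.
move=> h; elim: r => [|i r IH].
  by rewrite big_nil; under eq_fun do rewrite big_nil; exact: cvg_cst.
have [Pi|/negbTE Pi] := boolP (P i).
  rewrite big_cons Pi (_ : (fun n => _) = F i \+ fun n => \sum_(j <- r | P j) F j n).
    by apply: cvgD IH; exact: h.
  by apply/funext => n; rewrite big_cons Pi.
rewrite big_cons Pi (_ : (fun n => _) = fun n => \sum_(j <- r | P j) F j n) //.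
by apply/funext => n; rewrite big_cons Pi.
Qed.

Lemma cvgn_unique (f : nat -> C) l l' : f @ \oo --> l -> f @ \oo --> l' -> l = l'.
Proof. exact: cvg_unique. Qed.

(** Dominated interchange of two summations. The columns N are dominated by
    the summable b, so the rows are compared with the full sum on finitely
    many columns only, where the convergence in n is automatically uniform;
    the remaining columns contribute at most twice a tail of b. *)
Lemma double_series (d : nat -> nat -> C) (f A : nat -> C) (b : nat -> R) B :
    (forall n, series (d n) @ \oo --> f n) ->
    (forall N, series (d^~ N) @ \oo --> A N) ->
    (forall N m, \sum_(0 <= n < m) normc (d n N) <= b N) ->
    (forall M, \sum_(0 <= N < M) b N <= B) ->
  exists l, series f @ \oo --> l /\ series A @ \oo --> l.
Proof.
move=> df dA db bB.
have Ab N : normc (A N) <= b N by exact: abs_series_le (dA N) (db N).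
have b0 N : 0 <= b N by apply: le_trans (Ab N); exact: normc_ge0.
have [l Al] : exists l, series A @ \oo --> l.
  apply: (@abs_series_cvg _ B) => n; apply: le_trans (bB n); exact: ler_sum.
exists l; split => //; apply/cvgcP => e e0.
have e4 : 0 < e / 4 by rewrite divr_gt0.
(* Past N0 the columns contribute at most e / 4 + e / 4; before N0, finitely
   many columns converge. *)
have [N0 hN0] := small_tail b0 bB e4.
have cfin : (fun m => \sum_(0 <= N < N0) series (d^~ N) m) @ \oo -->
  \sum_(0 <= N < N0) A N.
  exact: (@cvgn_sum _ _ _ _ xpredT (fun N => series (d^~ N)) A (fun N _ => dA N)).
have /cvgcP/(_ _ e4) hfin := cfin.
near=> m.
have cm : (fun M => series A M - \sum_(0 <= n < m) series (d n) M) @ \oo -->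
    l - series f m.
  apply: cvgB Al _.
  exact: (@cvgn_sum _ _ _ _ xpredT (fun n => series (d n)) f (fun n _ => df n)).
apply: (cvgc_normc_le cm).
near=> M.
rewrite (exchange_big_nat) /= -sumrB (big_cat_nat (n := N0)) //=; last first.
  by near: M; exists N0.
have -> : e = e / 4 + e * (3 / 4) by lra.
apply: le_trans (le_normcD _ _) (lerD _ _).
  by rewrite sumrB; near: m.
apply: le_trans (ler_normc_sum _ _ _) _.
apply: (@le_trans _ _ (\sum_(N0 <= N < M) b N *+ 2)).
  apply: ler_sum => N _; apply: le_trans (le_normcD _ _) _.
  rewrite mulr2n lerD // normcN; apply: le_trans (ler_normc_sum _ _ _) (db _ _).
by rewrite sumrMnl; have := hN0 N0 M (leqnn _); lra.
Unshelve. all: by end_near.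
Qed.

Lemma sum_shift (V : nmodType) (w : nat -> V) k m : (k <= m)%N ->
  \sum_(0 <= n < m) (if (k <= n)%N then w (n - k)%N else 0) =
  \sum_(0 <= n < m - k) w n.
Proof.
move=> km; rewrite (big_cat_nat (n := k)) //= big_nat big1 ?add0r => [|n].
  rewrite -{1}[k]add0n big_addn; apply: eq_bigr => n _.
  by rewrite leq_addl addnK.
by move=> /= nk; rewrite leqNgt nk.
Qed.

(** The double array with entries u k * v (n - k), for k <= n, has the Cauchy
    products as row sums and the products u k * V as column sums. *)
Lemma cauchy_product u v (U V : C) (Bu Bv : R) :
    series u @ \oo --> U -> series v @ \oo --> V ->
    (forall n, \sum_(0 <= k < n) normc (u k) <= Bu) ->
    (forall n, \sum_(0 <= k < n) normc (v k) <= Bv) ->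
  series (fun n => \sum_(0 <= k < n.+1) u k * v (n - k)%N) @ \oo --> U * V.
Proof.
move=> uU vV uB vB.
pose d n k := if (k <= n)%N then u k * v (n - k)%N else 0.
have [||||l [fl Al]] := @double_series d
    (fun n => \sum_(0 <= k < n.+1) u k * v (n - k)%N) (fun k => u k * V)
    (fun k => normc (u k) * Bv) (Bu * Bv).
- move=> n; apply: cvg_near_cst; exists n.+1 => // M /= nM.
  rewrite /series /= (big_cat_nat (n := n.+1)) //= [X in _ + X]big_nat.
  rewrite [X in _ + X]big1 => [|k /andP[nk _]]; last by rewrite /d leqNgt nk.
  by rewrite addr0 big_nat [RHS]big_nat; apply: eq_bigr => k /andP[_];
  rewrite /d ltnS => ->.
- move=> k; rewrite -(@cvg_shiftn k _ (series _)).
  have -> : (fun n => series (d^~ k) (n + k)%N) = (fun n => u k * series v n).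
    apply/funext => n; rewrite /series /= mulr_sumr -[in RHS](addnK k n).
    rewrite -(sum_shift (fun n => u k * v n)) ?leq_addl //.
  exact: (cvgM (cvg_cst _) vV).
- move=> k m; have [km|mk] := leqP k m; last first.
    rewrite big_nat big1 => [|n /andP[_ nm]].
      by rewrite mulr_ge0 ?normc_ge0 // (le_trans _ (vB 0%N)) // big_geq.
    by rewrite /d leqNgt (ltn_trans nm mk) normc0.
  rewrite (_ : \sum_(0 <= n < m) _ = \sum_(0 <= n < m)
      if (k <= n)%N then normc (u k) * normc (v (n - k)%N) else 0); last first.
    by apply: eq_bigr => n _; rewrite /d; case: ifP; rewrite ?normcM ?normc0.
  rewrite (sum_shift (fun n => normc (u k) * normc (v n))) // -mulr_sumr.
  by rewrite ler_wpM2l ?normc_ge0.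
- by move=> M; rewrite -mulr_suml ler_wpM2r // (le_trans _ (vB 0%N)) // big_geq.
rewrite (_ : U * V = l) //.
have {}uU : series (fun k => u k * V) @ \oo --> U * V.
  have -> : series (fun k => u k * V) = (fun n => series u n * V).
    by apply/funext => n; rewrite /series /= mulr_suml.
  exact: (cvgM uU (cvg_cst V)).
exact: cvgn_unique uU Al.
Qed.

End ComplexSeries.

(** * Cauchy estimates and power series *)

Section PowerSeries.
Variable R : realType.
Local Notation C := R[i].
Implicit Types (a : nat -> C) (z l : C) (rho : R).

Lemma prim_root_exists n : (0 < n)%N -> exists w : C, n.-primitive_root w.
Proof.
move=> n0; pose p : {poly C} := 'X^n - 1.
have [r] := closed_field_poly_normal p.
rewrite (monicP _) ?monicXnsubC // scale1r => pE.
have runit : all n.-unity_root r.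
  by apply/allP => z; rewrite -root_prod_XsubC -pE.
have runiq : uniq r.
  by rewrite -separable_prod_XsubC -pE separable_Xn_sub_1 // pnatr_eq0 -lt0n.
have rsize : (n <= size r)%N.
  by rewrite -ltnS -(size_prod_XsubC r id) -pE size_XnsubC.
by have /hasP[w _ pw] := has_prim_root n0 runit runiq rsize; exists w.
Qed.

(** With w a primitive M-th root of unity, averaging w^((M - N) k) p(rho w^k)
    over k < M isolates the coefficient of degree N of a polynomial p of
    degree < M. This replaces the contour integral. *)
Lemma poly_cauchy_estimate a M N rho K : 0 <= rho -> (N < M)%N ->
    (forall z, normc z = rho -> normc (\sum_(0 <= j < M) a j * z ^+ j) <= K) ->
  normc (a N) * rho ^+ N <= K.
Proof.
move=> rho0 NM aK; have M0 : (0 < M)%N by exact: leq_ltn_trans NM.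
have [w pw] := prim_root_exists M0.
have w1 : normc w = 1.
  apply/eqP; rewrite -(@pexpr_eq1 _ _ M) ?normc_ge0 // -normcX.
  by rewrite (prim_expr_order pw) normc1.
have geo j : (j < M)%N ->
    \sum_(0 <= k < M) w ^+ ((M - N + j) * k) = if j == N then M%:R else 0.
  move=> jM; under eq_bigr do rewrite exprM.
  have [->|jN] := eqVneq j N.
    rewrite subnK ?(ltnW NM) // (prim_expr_order pw).
    by under eq_bigr do rewrite expr1n; rewrite sumr_const_nat subn0.
  have x1 : w ^+ (M - N + j) != 1.
    rewrite -(prim_order_dvd pw); apply/negP => /dvdnP[[|[|q]]] E; lia.
  apply: (mulfI (x := w ^+ (M - N + j) - 1)); first by rewrite subr_eq0.
  by rewrite big_mkord -subrX1 -exprM mulnC exprM (prim_expr_order pw) expr1n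
    subrr mulr0.
have main : \sum_(0 <= k < M) w ^+ ((M - N) * k) *
    (\sum_(0 <= j < M) a j * (rho%:C * w ^+ k) ^+ j) =
    M%:R * (a N * rho%:C ^+ N).
  under eq_bigr do rewrite mulr_sumr.
  rewrite exchange_big_nat /= (eq_big_nat _ _ (F2 := fun j =>
      a j * rho%:C ^+ j * (if j == N then M%:R else 0))) => [|j /andP[_ jM]].
    rewrite (bigD1_seq N) ?mem_index_iota ?iota_uniq //= eqxx big1 ?addr0.
      by rewrite mulrC.
    by move=> j /negbTE ->; rewrite mulr0.
  rewrite -geo // mulr_sumr; apply: eq_bigr => k _.
  by rewrite mulnDl exprD exprMn -[(w ^+ k) ^+ j]exprM (mulnC k); ring.
rewrite -(ler_pM2l (x := M%:R)) ?ltr0n //.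
have -> : M%:R * (normc (a N) * rho ^+ N) = normc (M%:R * (a N * rho%:C ^+ N)).
  by rewrite !normcM normc_nat normcX normc_real ger0_norm.
rewrite -main; apply: le_trans (ler_normc_sum _ _ _) _.
apply: (@le_trans _ _ (\sum_(0 <= k < M) K)).
  apply: ler_sum => k _; rewrite normcM normcX w1 expr1n mul1r; apply: aK.
  by rewrite normcM normcX w1 expr1n mulr1 normc_real ger0_norm.
by rewrite sumr_const_nat subn0 mulr_natl.
Qed.

(** On the circle, the truncations of the series are within e of the sum once
    their length is large; the polynomial estimate applies to them. *)
Lemma cauchy_estimate a (f : C -> C) rho K B N : 0 <= rho ->
    (forall n, \sum_(0 <= k < n) normc (a k) * rho ^+ k <= B) ->
    (forall z, normc z = rho -> series (fun k => a k * z ^+ k) @ \oo --> f z) ->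
    (forall z, normc z = rho -> normc (f z) <= K) ->
  normc (a N) * rho ^+ N <= K.
Proof.
move=> rho0 aB af fK; apply/ler_addgt0Pr => e e0.
have [n0 hn0] : exists n0, forall n m, (n0 <= n)%N ->
    \sum_(n <= k < m) normc (a k) * rho ^+ k <= e.
  apply: (small_tail _ aB e0) => n.
  by rewrite mulr_ge0 ?normc_ge0 ?exprn_ge0.
apply: (@poly_cauchy_estimate _ (n0 + N.+1)) => //; first by rewrite leq_addl.
move=> z zr; set M := (n0 + N.+1)%N.
have h : normc (f z - \sum_(0 <= j < M) a j * z ^+ j) <= e.
  have fM : (fun m => series (fun k => a k * z ^+ k) m -
      \sum_(0 <= j < M) a j * z ^+ j) @ \oo --> f z - \sum_(0 <= j < M) a j * z ^+ j.
    by apply: cvgB; [exact: af|exact: cvg_cst].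
  apply: (cvgc_normc_le fM); exists M => // m /= Mm.
  rewrite (sub_series_geq _ Mm); apply: le_trans (ler_normc_sum _ _ _) _.
  under eq_bigr do rewrite normcM normcX zr.
  by apply: hn0; rewrite leq_addr.
rewrite -[X in normc X](subKr (f z)); apply: le_trans (le_normcD _ _) _.
by rewrite normcN lerD ?fK.
Qed.

Lemma near0P (P : set C) :
  (\forall z \near (0 : C), P z) <->
  exists2 r : R, 0 < r & forall z, normc z < r -> P z.
Proof.
split=> [/nbhs_normP[e /= e0 h]|[r r0 h]].
  have er : e \is Num.real by exact: gtr0_real.
  exists (complex.Re e); first by rewrite -ltcR RRe_real.
  move=> z zr; apply: h => /=.
  by rewrite sub0r normrN normrcE -(RRe_real er) ltcR.
apply/nbhs_normP; exists r%:C; first by rewrite /= ltcR.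
by move=> z /=; rewrite sub0r normrN normrcE ltcR; exact: h.
Qed.

Lemma sum_half_le (n : nat) : \sum_(0 <= k < n) (2^-1 : R) ^+ k <= 2.
Proof.
suff -> : \sum_(0 <= k < n) (2^-1 : R) ^+ k = 2 - 2 * 2^-1 ^+ n.
  by rewrite gerBl mulr_ge0 // exprn_ge0.
elim: n => [|n IH]; first by rewrite big_geq // expr0; ring.
by rewrite big_nat_recr //= IH exprS; field.
Qed.

Lemma sum_geometric_le (b : nat -> R) rho K n : 0 < rho ->
    (forall k, 0 <= b k) -> (forall k, b k * rho ^+ k <= K) ->
  \sum_(0 <= k < n) b k * (rho / 2) ^+ k <= K * 2.
Proof.
move=> rho0 b0 bK; apply: (@le_trans _ _ (\sum_(0 <= k < n) K * 2^-1 ^+ k)).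
  apply: ler_sum => k _; rewrite exprMn mulrA.
  by rewrite ler_wpM2r ?exprn_ge0.
rewrite -mulr_sumr ler_wpM2l ?sum_half_le // (le_trans _ (bK 0%N)) //.
by rewrite mulr_ge0.
Qed.

(** The difference expands the zero function, whose Cauchy estimate has the
    constant 0. Terms of a convergent series are bounded, so on half the
    radius the series converges absolutely. *)
Lemma expansion_unique (f : C -> C) a b :
  has_expansion f a -> has_expansion f b -> a = b.
Proof.
move=> fa fb; pose c k := a k - b k.
have [r r0 hr] : exists2 r : R, 0 < r & forall z, normc z < r ->
    series (fun k => c k * z ^+ k) @ \oo --> (0 : C).
  apply/near0P; apply: filterS2 fa fb => z za zb.
  rewrite (_ : series _ = series (fun k => a k * z ^+ k) \- series (fun k => b k * z ^+ k)).
    by rewrite -(subrr (f z)); exact: cvgB.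
  apply/funext => n; rewrite /series /= -sumrB.
  by apply: eq_bigr => k _; rewrite mulrBl.
have r2 : 0 < r / 2 by rewrite divr_gt0.
have [B cB] : exists B, forall k, normc (c k) * (r / 2) ^+ k <= B.
  have /hr h : normc (r / 2)%:C < r by rewrite normc_real gtr0_norm //; lra.
  have /cvgcP/(_ _ ltr01)[n0 _ hn0] : (fun k => c k * (r / 2)%:C ^+ k) @ \oo --> (0 : C).
    by apply: cvg_series_cvg_0; exact: cvgP h.
  exists (1 + \sum_(0 <= k < n0) normc (c k) * (r / 2) ^+ k) => k.
  have t0 j : 0 <= normc (c j) * (r / 2) ^+ j.
    by rewrite mulr_ge0 ?normc_ge0 ?exprn_ge0 ?ltW.
  have [n0k|kn0] := leqP n0 k.
    have := hn0 k n0k; rewrite /= sub0r normcN normcM normcX normc_real.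
    by rewrite gtr0_norm // => /le_trans -> //; rewrite lerDl sumr_ge0.
  rewrite (bigD1_seq k) ?mem_index_iota ?iota_uniq //= addrCA lerDl.
  by rewrite addr_ge0 ?sumr_ge0.
apply/funext => N; apply/subr0_eq/eq0_normc/eqP.
have r40 : 0 < r / 2 / 2 by rewrite divr_gt0.
rewrite eq_le normc_ge0 andbT -(ler_pM2r (exprn_gt0 N r40)) mul0r.
apply: (@cauchy_estimate c (fun=> 0) _ _ (B * 2)); first exact: ltW.
- by move=> n; apply: sum_geometric_le => // k; exact: normc_ge0.
- by move=> z zr; apply: hr; rewrite zr; lra.
- by move=> z _; rewrite normc0.
Qed.

(** Taylor remainder of order two of z ^ n. It satisfies e_(n+1) = (z + h) e_n
    + n h^2 z^(n-1), which gives the bound by induction. *)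
Lemma expr_shift_bound (z h : C) (s : R) n : 0 < s ->
    normc z <= s -> normc (z + h) <= s ->
  normc ((z + h) ^+ n - z ^+ n - h * (n%:R * z ^+ n.-1)) <=
  normc h ^+ 2 / s ^+ 2 * (n%:R ^+ 2 * s ^+ n).
Proof.
move=> s0 zs zhs; elim: n => [|n IH].
  rewrite !expr0 subrr mul0r mulr0 subrr normc0.
  by rewrite mulr_ge0 ?divr_ge0 ?exprn_ge0 ?normc_ge0 // ltW.
have -> : (z + h) ^+ n.+1 - z ^+ n.+1 - h * (n.+1%:R * z ^+ n) =
    (z + h) * ((z + h) ^+ n - z ^+ n - h * (n%:R * z ^+ n.-1)) +
    h ^+ 2 * (n%:R * z ^+ n.-1).
  case: n {IH} => [|n] /=; first by rewrite !expr0 !expr1; ring.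
  by rewrite -(natr1 n.+1) !exprS; ring.
apply: le_trans (le_normcD _ _) _.
have h1 : normc (h ^+ 2 * (n%:R * z ^+ n.-1)) <=
    normc h ^+ 2 / s ^+ 2 * (n%:R * s ^+ n.+1).
  rewrite normcM normcX normcM normcX normc_nat -mulrA ler_wpM2l ?sqr_ge0 //.
  case: n {IH} => [|n] /=; first by rewrite !mul0r mulr0.
  rewrite mulrCA ler_wpM2l // -[n.+2]/(2 + n)%N exprD mulKf ?expf_neq0 ?gt_eqF //.
  by rewrite lerXn2r ?nnegrE ?normc_ge0 ?(ltW s0).
have h2 : normc ((z + h) * ((z + h) ^+ n - z ^+ n - h * (n%:R * z ^+ n.-1))) <=
    normc h ^+ 2 / s ^+ 2 * (n%:R ^+ 2 * s ^+ n.+1).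
  rewrite normcM (exprS s n) !(mulrCA _ s) ler_pM ?normc_ge0 //.
apply: le_trans (lerD h2 h1) _; rewrite -mulrDr -mulrDl.
rewrite ler_wpM2l ?divr_ge0 ?sqr_ge0 // ler_wpM2r ?exprn_ge0 ?(ltW s0) //.
by rewrite -natr1; have : 0 <= (n%:R : R) by []; nra.
Qed.

Lemma natr_le_expr2 n : n%:R <= (2 : R) ^+ n.
Proof. by rewrite -natrX ler_nat ltnW // ltn_expl. Qed.

(** Termwise differentiation. The remainder bound has the factor N^2 s^N;
    shrinking the radius from rho to rho / 8 turns it into rho^N 2^-N, because
    N^2 <= 4^N. *)
Lemma power_series_derivable a (g : C -> C) rho K : 0 < rho ->
    (forall N, normc (a N) * rho ^+ N <= K) ->
    (forall z, normc z < rho -> series (fun N => a N * z ^+ N) @ \oo --> g z) ->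
  forall z, normc z < rho / 8 -> derivable g z 1.
Proof.
move=> rho0 aK ag z zs.
set s := rho / 8 in zs *; have s0 : 0 < s by rewrite divr_gt0.
have srho : s < rho by rewrite /s; lra.
have term N : normc (a N) * (N%:R ^+ 2 * s ^+ N) <= K * 2^-1 ^+ N.
  have -> : s ^+ N = rho ^+ N * 2^-1 ^+ N * (2^-1 ^+ N) ^+ 2.
    by rewrite -exprM mulnC exprM -!exprMn /s; congr (_ ^+ _); field.
  rewrite (_ : normc (a N) * _ = normc (a N) * rho ^+ N * 2^-1 ^+ N *
      (N%:R * 2^-1 ^+ N) ^+ 2); last by ring.
  rewrite -[leRHS]mulr1; apply: ler_pM; rewrite ?sqr_ge0 ?mulr_ge0 ?exprn_ge0 ?normc_ge0 ?(ltW rho0) //.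
    by rewrite ler_wpM2r ?exprn_ge0.
  rewrite expr_le1 ?mulr_ge0 ?exprn_ge0 // exprVn ler_pdivrMr ?exprn_gt0 //.
  by rewrite mul1r natr_le_expr2.
have term_sum m : \sum_(0 <= N < m) normc (a N) * (N%:R ^+ 2 * s ^+ N) <= K * 2.
  apply: (@le_trans _ _ (\sum_(0 <= N < m) K * 2^-1 ^+ N)); first exact: ler_sum.
  have K0 : 0 <= K by apply: le_trans (aK 0%N); rewrite mulr_ge0 ?normc_ge0.
  by rewrite -mulr_sumr ler_wpM2l ?sum_half_le.
have [D hD] : exists D : C, series (fun N => a N * (N%:R * z ^+ N.-1)) @ \oo --> D.
  apply: (@abs_series_cvg _ _ (K * 2 / s)) => m.
  rewrite ler_pdivlMr //; apply: le_trans (term_sum m).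
  rewrite mulr_suml; apply: ler_sum => -[|N] _.
    by rewrite !normcM normc0 !(mul0r, mulr0) expr0n !(mul0r, mulr0).
  rewrite !normcM normc_nat normcX /= -mulrA ler_wpM2l ?normc_ge0 //.
  have zN : normc z ^+ N * s <= s ^+ N.+1.
    by rewrite exprSr ler_wpM2r ?(ltW s0) // lerXn2r ?nnegrE ?normc_ge0 ?ltW.
  have N1 : (N.+1%:R : R) <= N.+1%:R ^+ 2 by rewrite -natrX ler_nat leq_pmulr.
  rewrite -mulrA; apply: ler_pM => //.
  by rewrite mulr_ge0 ?exprn_ge0 ?normc_ge0 ?(ltW s0).
pose K' := K * 2 / s ^+ 2.
(* The quotient differs from D by O(h), since the remainder is quadratic in h.
   *)
have quad h : normc h <= s - normc z -> normc (g (z + h) - g z - h * D) <=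
    normc h ^+ 2 * K'.
  move=> hs; have zhs : normc (z + h) <= s.
    by apply: le_trans (le_normcD _ _) _; lra.
  have := @abs_series_le _ (fun N =>
    a N * ((z + h) ^+ N - z ^+ N - h * (N%:R * z ^+ N.-1))) (g (z + h) - g z - h * D).
  apply.
    rewrite (_ : series _ = (fun m => series (fun N => a N * (z + h) ^+ N) m -
       series (fun N => a N * z ^+ N) m -
       h * series (fun N => a N * (N%:R * z ^+ N.-1)) m)).
      apply: cvgB; last exact: (cvgM (cvg_cst h) hD).
      apply: cvgB; apply: ag; first exact: le_lt_trans srho.
      exact: lt_trans srho.
    apply/funext => m; rewrite /series /= mulr_sumr -!sumrB.
    by apply: eq_bigr => N _; ring.
  move=> m; rewrite /K' [leRHS](_ : _ = K * 2 * (normc h ^+ 2 / s ^+ 2)); last by ring.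
  apply: (@le_trans _ _ (\sum_(0 <= N < m)
     normc (a N) * (N%:R ^+ 2 * s ^+ N) * (normc h ^+ 2 / s ^+ 2))).
    apply: ler_sum => N _; rewrite normcM -mulrA ler_wpM2l ?normc_ge0 //.
    by rewrite [leRHS]mulrC; apply: expr_shift_bound => //; exact: ltW.
  by rewrite -mulr_suml ler_wpM2r // divr_ge0 ?sqr_ge0.
have K'0 : 0 <= K'.
  by rewrite divr_ge0 ?sqr_ge0 // (le_trans _ (term_sum 0%N)) // big_geq.
apply/cvg_ex; exists D; apply/cvgcP => e e0; rewrite near_withinE.
have d0 : 0 < Num.min (s - normc z) (e / (K' + 1)).
  by rewrite lt_min subr_gt0 zs divr_gt0 // ltr_wpDl.
apply/near0P; exists (Num.min (s - normc z) (e / (K' + 1))) => // h.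
rewrite lt_min => /andP[hs he] /= h0.
rewrite [h *: 1]mulr1 [h + z]addrC.
have nh0 : 0 < normc h.
  by rewrite lt_neqAle normc_ge0 andbT eq_sym; apply: contra h0 => /eqP/eq0_normc->.
rewrite -(ler_pM2l nh0) -normcM -normcN.
rewrite [X in normc X <= _](_ : _ = g (z + h) - g z - h * D); last first.
  by rewrite mulrBr opprB [h * (_ *: _)]mulVKf.
apply: le_trans (quad _ (ltW hs)) _.
rewrite expr2 -mulrA ler_wpM2l ?normc_ge0 //.
move: he; rewrite ltr_pdivlMr ?ltr_wpDl // => /ltW; apply: le_trans.
by rewrite ler_wpM2l ?normc_ge0 // lerDl.
Qed.

End PowerSeries.

(** * Words over the two alphabets, graded by length and weight *)

Section Words.

Lemma admissible_cons (a : bool) u :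
  admissible (a :: u) = admissible u && ((u == [::]) ==> a).
Proof. by case: u => [|b u] /=; rewrite /admissible ?andbT //; case: a. Qed.

Lemma shuffle_admissible u v w : admissible u -> admissible v ->
  w \in shuffle u v -> admissible w.
Proof.
elim: u v w => [|a u IHu] v w; first by case: v => [|b v] _ ?; rewrite inE => /eqP->.
elim: v w => [|b v IHv] w Au Av; first by rewrite inE => /eqP->.
have [Au' _] := andP (etrans (esym (admissible_cons _ _)) Au).
have [Av' _] := andP (etrans (esym (admissible_cons _ _)) Av).
rewrite mem_cat => /orP[] /mapP[w' hw' ->]; rewrite admissible_cons.
  rewrite (IHu _ _ Au' Av hw') /=; apply/implyP => /eqP w0.
  by have := shuffle_size hw'; rewrite w0 /= addnS.
rewrite (IHv _ Au Av' hw') /=; apply/implyP => /eqP w0.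
by have := @shuffle_size _ (a :: u) v w' hw'; rewrite w0.
Qed.

Lemma yword_of_recS k w : yword_of_rec k.+1 w =
  if yword_of_rec k w is j :: v then j.+1 :: v else [::].
Proof. by elim: w k => //= -[] w IH k /=. Qed.

Lemma yword_of_nil w : admissible w -> (yword_of w == [::]) = (w == [::]).
Proof.
move=> Aw; apply/eqP/eqP => [h|->] //.
by rewrite -(yword_ofK Aw) h.
Qed.

Lemma size_xword_of v : size (xword_of v) = sumn (map succn v).
Proof.
elim: v => //= k v IH; rewrite /xword_of /= -/(xword_of v) size_cat IH.
by rewrite size_rcons size_nseq.
Qed.

Lemma admissible_xword_of v : admissible (xword_of v).
Proof.
elim: v => //= k v IH; rewrite /xword_of /= -/(xword_of v) cat_rcons.
elim: k => [|k IHk] /=; first by rewrite admissible_cons IH implybT.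
by rewrite admissible_cons IHk; case: k {IHk}.
Qed.

Definition xwords n : seq (seq bool) :=
  [seq w <- [seq val t | t <- enum {: n.-tuple bool}] | admissible w].
Definition ywords n : seq (seq nat) := map yword_of (xwords n).
Definition weight (v : seq nat) : nat := sumn (map succn v).

Lemma mem_xwords n w : (w \in xwords n) = admissible w && (size w == n).
Proof.
rewrite mem_filter; congr (_ && _); apply/mapP/eqP => [[t _ ->]|<-].
  exact: size_tuple.
by exists (in_tuple w); rewrite ?mem_enum.
Qed.

Lemma uniq_xwords n : uniq (xwords n).
Proof. by rewrite filter_uniq // map_inj_uniq ?enum_uniq //; exact: val_inj. Qed.

Lemma mem_ywords n v : (v \in ywords n) = (weight v == n).
Proof.
apply/mapP/eqP => [[w + ->]|<-].
  rewrite mem_xwords => /andP[Aw /eqP <-].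
  by rewrite -[in RHS](yword_ofK Aw) size_xword_of.
exists (xword_of v); last by rewrite xword_ofK.
by rewrite mem_xwords admissible_xword_of size_xword_of eqxx.
Qed.

Lemma uniq_ywords n : uniq (ywords n).
Proof.
rewrite map_inj_in_uniq ?uniq_xwords // => w w'.
rewrite !mem_xwords => /andP[Aw _] /andP[Aw' _] e.
by rewrite -(yword_ofK Aw) e yword_ofK.
Qed.

End Words.

Section BilinearExtension.
Variables (R : realType) (A : choiceType).
Local Notation C := R[i].
Variables (op : seq A -> seq A -> seq (seq A)).
Variables (wt : seq A -> nat) (W : nat -> seq (seq A)).
Hypothesis uniqW : forall n, uniq (W n).
Hypothesis wtW : forall n u, u \in W n -> wt u = n.
Hypothesis opW : forall i j u v w,
  u \in W i -> v \in W j -> w \in op u v -> w \in W (i + j)%N.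

Lemma sum_count (s r : seq (seq A)) (L : seq A -> C) : uniq r ->
    {subset s <= r} ->
  \sum_(w <- r) (count_mem w s)%:R * L w = \sum_(w <- s) L w.
Proof.
move=> ur; elim: s => [_|x s IH sr].
  by rewrite big_nil big1 // => w _; rewrite mul0r.
rewrite big_cons -IH => [|w ws]; last by apply: sr; rewrite inE ws orbT.
rewrite (eq_bigr (fun w => (x == w)%:R * L w + (count_mem w s)%:R * L w)).
  rewrite big_split /= (bigD1_seq x) ?sr ?mem_head //= eqxx mul1r big1 ?addr0 //.
  by move=> w /negbTE; rewrite eq_sym => ->; rewrite mul0r.
by move=> w _ /=; rewrite natrD mulrDl.
Qed.

(** Evaluation of a linear functional L on a homogeneous component of a
    product that respects a grading W: since W i and W j are finite, the
    infinitely many pairs of the bilinear extension reduce to those with i + j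
    = n. *)
Lemma sum_bilinear_ext (S T : ncseries R A) (L : seq A -> C) n :
    (forall u, S u != 0 -> u \in W (wt u)) ->
    (forall u, T u != 0 -> u \in W (wt u)) ->
  \sum_(w <- W n) bilinear_ext op S T w * L w =
  \sum_(0 <= i < n.+1) \sum_(u <- W i) \sum_(v <- W (n - i)%N)
    S u * T v * \sum_(w <- op u v) L w.
Proof.
move=> SW TW.
(* The pairs that can contribute, listed without repetition by the weight of
   their first component. *)
pose pairs i := [seq (u, v) | u <- W i, v <- W (n - i)%N].
pose P := [seq p | i <- index_iota 0 n.+1, p <- pairs i].
have memP u v : ((u, v) \in P) =
    (u \in W (wt u)) && (v \in W (wt v)) && (wt u + wt v == n)%N.
  apply/allpairsPdep/idP => [[i [p [+ + pE]]]|].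
    rewrite mem_index_iota /= ltnS => ile; rewrite -pE => /allpairsP[[u' v'] /= [Wu Wv [-> ->]]].
    by rewrite (wtW Wu) (wtW Wv) Wu Wv subnKC ?eqxx.
  move=> /andP[/andP[Wu Wv] /eqP wuv]; exists (wt u), (u, v); split => //.
    by rewrite mem_index_iota /= ltnS -wuv leq_addr.
  apply/allpairsP; exists (u, v); split => //=.
  by rewrite -wuv addKn.
have uniqP : uniq P.
  apply: allpairs_uniq_dep; first exact: iota_uniq.
    move=> i _; apply: allpairs_uniq; [exact: uniqW|exact: uniqW|].
    by move=> [u v] [u' v'] _ _ /=.
  have wtP x : x \in [seq @Tagged nat i (fun=> (seq A * seq A)%type) p |
      i <- index_iota 0 n.+1, p <- pairs i] -> tag x = wt (tagged x).1.
    case/allpairsPdep => i [p [_ /allpairsP[[u v] [/= Wu _ pE]] xE]].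
    by rewrite xE /= pE /= (wtW Wu).
  move=> [i p] [j q] /wtP /= -> /wtP /= -> /= pq.
  by rewrite pq.
have extE w : w \in W n -> bilinear_ext op S T w =
    \sum_(p <- P) S p.1 * T p.2 * (count_mem w (op p.1 p.2))%:R.
  move=> Ww; rewrite /bilinear_ext [RHS]fsbig_seq //; apply/esym/fsbig_widen => //.
  move=> [u v] [_ /= uvP]; apply/eqP; rewrite -[_ == _]negbK; apply: contra_notN uvP.
  rewrite !mulf_eq0 !negb_or pnatr_eq0 -lt0n => /andP[/andP[Su Tv]].
  rewrite -has_count => /hasP[w' ww' /eqP w'E]; rewrite w'E in ww'.
  by rewrite memP SW ?TW //= -(wtW (opW (SW _ Su) (TW _ Tv) ww')) (wtW Ww).
transitivity (\sum_(w <- W n) \sum_(p <- P)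
    S p.1 * T p.2 * ((count_mem w (op p.1 p.2))%:R * L w)).
  rewrite big_seq [RHS]big_seq; apply: eq_bigr => w Ww.
  by rewrite extE // mulr_suml; apply: eq_bigr => p _; rewrite mulrA.
rewrite exchange_big /= /P big_allpairs_dep /= /index_iota subn0.
rewrite big_seq [RHS]big_seq; apply: eq_bigr => i; rewrite mem_iota /= add0n ltnS => ile.
rewrite big_allpairs_dep /= big_seq [RHS]big_seq; apply: eq_bigr => u Wu.
rewrite big_seq [RHS]big_seq; apply: eq_bigr => v Wv.
rewrite -mulr_sumr sum_count // => w uvw.
by have := opW Wu Wv uvw; rewrite subnKC.
Qed.
End BilinearExtension.

(** * Taylor coefficients of polylogarithms *)

Section PolylogCoefficients.
Variable R : realType.
Local Notation C := R[i].
Implicit Types (u v : seq nat) (z : C) (f g : nat -> C).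

(** The coefficient of z^N in the polylogarithm of v. For N = 0 and v nonempty
    it is a quotient by 0, hence 0. *)
Definition li_coef v (N : nat) : C :=
  if v is k :: v' then harmonic_sum R v' N / N%:R ^+ k.+1 else (N == 0)%:R.

Lemma li_coef0 v : v != [::] -> li_coef v 0 = 0.
Proof. by case: v => //= k v _; rewrite expr0n invr0 mulr0. Qed.

Lemma harmonic_sum_cons k v M :
  harmonic_sum R (k :: v) M = \sum_(0 <= n < M) li_coef (k :: v) n.
Proof.
case: M => [|M]; first by rewrite /= !big_geq.
by rewrite [RHS]big_ltn // li_coef0 // add0r.
Qed.

Lemma harmonic_sumE v N : harmonic_sum R v N.+1 = \sum_(0 <= n < N.+1) li_coef v n.
Proof.
case: v => [|k v]; last exact: harmonic_sum_cons.
by rewrite big_ltn // big_nat big1 ?addr0 // => -[].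
Qed.

Lemma harmonic_sumS k v M : harmonic_sum R (k :: v) M.+1 =
  harmonic_sum R (k :: v) M + harmonic_sum R v M / M%:R ^+ k.+1.
Proof. by rewrite !harmonic_sum_cons big_nat_recr. Qed.

Lemma normc_div_nat_le z N k : normc (z / N%:R ^+ k) <= normc z.
Proof.
rewrite normcM normcV normcX normc_nat ler_piMr ?normc_ge0 //.
case: N => [|N]; first by case: k => [|k]; rewrite ?invr1 // expr0n invr0.
by rewrite invf_le1 ?exprn_gt0 ?ltr0n // exprn_ege1 // ler1n.
Qed.

Lemma sum_expr2_le M : \sum_(0 <= n < M) (2 : R) ^+ n <= 2 ^+ M.
Proof.
elim: M => [|M IH]; first by rewrite big_geq // expr0.
by rewrite big_nat_recr //= exprS mulr_natl mulr2n lerD.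
Qed.

(** A bound that is uniform in the word: the polylogarithms then all expand
    absolutely on the same disc of radius 1/4. *)
Lemma normc_harmonic_sum_le v M : normc (harmonic_sum R v M) <= 2 ^+ M.
Proof.
elim: v M => [|k v IH] M; first by rewrite normc1 exprn_ege1 // ler1n.
rewrite harmonic_sum_cons; apply: le_trans (ler_normc_sum _ _ _) _.
apply: le_trans (sum_expr2_le M); apply: ler_sum => n _ /=.
exact: le_trans (normc_div_nat_le _ _ _) (IH n).
Qed.

Lemma normc_li_coef_le v N : normc (li_coef v N) <= 2 ^+ N.
Proof.
case: v => [|k v] /=.
  by case: N => [|N]; rewrite ?normc1 ?expr0 // normc0 exprn_ge0.
exact: le_trans (normc_div_nat_le _ _ _) (normc_harmonic_sum_le _ _).
Qed.

Lemma sum_li_coef_le v n :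
  \sum_(0 <= N < n) normc (li_coef v N) * 4^-1 ^+ N <= 2.
Proof.
apply: le_trans (sum_half_le R n); apply: ler_sum => N _.
apply: (@le_trans _ _ (2 ^+ N * 4^-1 ^+ N)).
  by rewrite ler_wpM2r ?exprn_ge0 // normc_li_coef_le.
by rewrite -exprMn (_ : 2 * 4^-1 = 2^-1 :> R) //; field.
Qed.

Lemma polylog_series v z : normc z <= 4^-1 ->
  series (fun N => li_coef v N * z ^+ N) @ \oo --> polylog v z.
Proof.
move=> z4; have [l hl] : exists l : C, series (fun N => li_coef v N * z ^+ N) @ \oo --> l.
  apply: (@abs_series_cvg _ _ 2) => n; apply: le_trans (sum_li_coef_le v n).
  apply: ler_sum => N _; rewrite normcM normcX ler_wpM2l ?normc_ge0 //.
  by rewrite lerXn2r ?nnegrE ?normc_ge0.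
rewrite (_ : polylog v z = l) //.
case: v => [|k v] in hl *.
  apply: (cvgn_unique _ hl) => /=; apply: cvg_near_cst; exists 1%N => // n /= n0.
  rewrite /series /= big_ltn // expr0 mulr1 eqxx big_nat big1 ?addr0 //.
  by move=> [|N] //= _; rewrite mul0r.
rewrite /= (_ : (fun M => _) = series (fun N => li_coef (k :: v) N * z ^+ N)).
  exact: cvg_lim hl.
apply/funext => M.
rewrite /series /=; case: M => [|M]; first by rewrite !big_geq.
rewrite [RHS]big_ltn // -/(li_coef (k :: v) 0) li_coef0 // mul0r add0r.
by apply: eq_bigr => n _; rewrite [RHS]mulrC mulrA.
Qed.

(** Induction on M. Passing from M to M + 1 adds to each factor its term with
    outermost index M, and the three cross terms of the product correspond to
    the three branches of the stuffle. *)
Lemma harmonic_sum_stuffle u v M :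
  harmonic_sum R u M * harmonic_sum R v M = \sum_(w <- stuffle u v) harmonic_sum R w M.
Proof.
elim: u v M => [|j u IHu] v M; first by case: v => [|k v]; rewrite big_seq1 mul1r.
elim: v M => [|k v IHv] M; first by rewrite big_seq1 mulr1.
have split_stuffle N : \sum_(w <- stuffle (j :: u) (k :: v)) harmonic_sum R w N =
    \sum_(w <- stuffle u (k :: v)) harmonic_sum R (j :: w) N +
    (\sum_(w <- stuffle (j :: u) v) harmonic_sum R (k :: w) N +
     \sum_(w <- stuffle u v) harmonic_sum R ((j + k).+1 :: w) N).
  have -> : stuffle (j :: u) (k :: v) = [seq j :: w | w <- stuffle u (k :: v)] ++
    [seq k :: w | w <- stuffle (j :: u) v] ++ [seq (j + k).+1 :: w | w <- stuffle u v].
    by [].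
  by rewrite !big_cat !big_map.
have sumS n s N : \sum_(w <- s) harmonic_sum R (n :: w) N.+1 =
    \sum_(w <- s) harmonic_sum R (n :: w) N +
    (\sum_(w <- s) harmonic_sum R w N) / N%:R ^+ n.+1.
  by rewrite mulr_suml -big_split; apply: eq_bigr => w _; rewrite harmonic_sumS.
have sum0 n s : \sum_(w <- s) harmonic_sum R (n :: w) 0 = 0.
  by rewrite big1 // => w _; rewrite harmonic_sum_cons big_geq.
rewrite split_stuffle; elim: M => [|M IH].
  by rewrite !sum0 !harmonic_sum_cons !big_geq // mul0r !addr0.
rewrite !sumS -!IHu -IHv !harmonic_sumS.
have -> : (j + k).+2 = (j.+1 + k.+1)%N by rewrite addSn addnS.
rewrite exprD invfM.
ring: IH.
Qed.

Definition cauchy_conv f g (N : nat) : C := \sum_(0 <= k < N.+1) f k * g (N - k)%N.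

Lemma cauchy_convC f g N : cauchy_conv f g N = cauchy_conv g f N.
Proof.
rewrite /cauchy_conv big_nat_rev /= add0n big_nat [RHS]big_nat.
apply: eq_bigr => k /andP[_]; rewrite ltnS => kN.
by rewrite subSS mulrC subKn.
Qed.

Lemma cauchy_conv_delta f N : cauchy_conv (fun k => (k == 0)%:R) f N = f N.
Proof.
rewrite /cauchy_conv big_ltn // eqxx mul1r subn0 big_nat big1 ?addr0 //.
by move=> [|k] //= _; rewrite mul0r.
Qed.

(** Leibniz rule for the Euler derivation z d/dz, which multiplies the N-th
    coefficient by N. *)
Lemma euler_conv f g N : N%:R * cauchy_conv f g N =
  cauchy_conv (fun k => k%:R * f k) g N + cauchy_conv f (fun k => k%:R * g k) N.
Proof.
rewrite /cauchy_conv mulr_sumr -big_split /= big_nat [RHS]big_nat.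
apply: eq_bigr => k /andP[_]; rewrite ltnS => kN.
by rewrite -{1}(subnKC kN) natrD; ring.
Qed.

(** Multiplication by z/(1-z) for x1 and by 1 for x0: these are the factors in
    z Li_(xw)'(z) = Li_w(z) z/(1-z), resp. Li_w(z). *)
Definition letter_mul (b : bool) f N : C := if b then \sum_(0 <= k < N) f k else f N.

Lemma letter_mul_conv b f g N :
  cauchy_conv (letter_mul b f) g N = letter_mul b (cauchy_conv f g) N.
Proof.
case: b => //=; elim: N => [|N IH].
  by rewrite /cauchy_conv big_nat1 /letter_mul !big_geq // mul0r.
rewrite [RHS]big_nat_recr //= -IH /cauchy_conv big_nat_recl //= (@big_geq _ _ _ 0 0) // mul0r add0r.
rewrite -big_split /= big_nat [RHS]big_nat; apply: eq_bigr => k _.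
by rewrite subSS big_nat_recr //= mulrDl.
Qed.

Lemma letter_mul_sum (I : Type) (r : seq I) b (F : I -> nat -> C) N :
  letter_mul b (fun k => \sum_(i <- r) F i k) N = \sum_(i <- r) letter_mul b (F i) N.
Proof. by case: b => //=; rewrite exchange_big. Qed.

Local Notation xcoef w := (li_coef (yword_of w)).

(** The differential equations of the polylogarithms, on coefficients. If b is
    x0 then w is nonempty and ends in x1, so x0 raises the first index of its
    Y-word by one. *)
Lemma euler_xcoef (b : bool) w N : admissible (b :: w) ->
  N%:R * xcoef (b :: w) N = letter_mul b (xcoef w) N.
Proof.
rewrite admissible_cons => /andP[Aw wb].
case: N => [|N].
  rewrite mul0r; case: b wb => [|wb] /=; first by rewrite big_geq.
  rewrite li_coef0 // yword_of_nil //; by case: w wb {Aw}.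
have N0 : (N.+1%:R : C) != 0 by rewrite pnatr_eq0.
case: b wb => wb /=.
  rewrite -harmonic_sumE expr1. by rewrite mulrCA divff ?mulr1.
have : yword_of w != [::] by rewrite yword_of_nil //; case: w wb {Aw}.
rewrite /yword_of /= yword_of_recS; case: (yword_of_rec 0 w) => //= k v _.
by rewrite (exprS _ k.+1) invfM mulrCA mulVKf.
Qed.

(** Both sides have the same image under the Euler derivation, by the Leibniz
    rule and induction on the words, and the same constant coefficient 0 when
    the words are nonempty. *)
Lemma li_coef_shuffle (u v : seq bool) N : admissible u -> admissible v ->
  cauchy_conv (xcoef u) (xcoef v) N = \sum_(w <- shuffle u v) xcoef w N.
Proof.
elim: u v N => [|a u IHu] v N.
  by move=> _ _; rewrite cauchy_conv_delta; case: v => [|b v]; rewrite big_seq1.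
elim: v N => [|b v IHv] N Au Av; first by rewrite cauchy_convC cauchy_conv_delta big_seq1.
have [Au' _] := andP (etrans (esym (admissible_cons _ _)) Au).
have [Av' _] := andP (etrans (esym (admissible_cons _ _)) Av).
case: N => [|N].
  rewrite /cauchy_conv big_nat1 li_coef0 ?mul0r ?yword_of_nil // big_seq big1 // => w hw.
  rewrite li_coef0 // yword_of_nil; last exact: shuffle_admissible hw.
  by apply/eqP => w0; have := shuffle_size hw; rewrite w0.
have N0 : (N.+1%:R : C) != 0 by rewrite pnatr_eq0.
apply: (mulfI N0); rewrite euler_conv.
have -> : (fun k => k%:R * xcoef (a :: u) k) = letter_mul a (xcoef u).
  by apply/funext => k; rewrite euler_xcoef.
have -> : (fun k => k%:R * xcoef (b :: v) k) = letter_mul b (xcoef v).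
  by apply/funext => k; rewrite euler_xcoef.
rewrite letter_mul_conv cauchy_convC letter_mul_conv.
have -> : cauchy_conv (xcoef u) (xcoef (b :: v)) = fun k => \sum_(w <- shuffle u (b :: v)) xcoef w k.
  by apply/funext => k; rewrite IHu.
have -> : cauchy_conv (xcoef v) (xcoef (a :: u)) = fun k => \sum_(w <- shuffle (a :: u) v) xcoef w k.
  by apply/funext => k; rewrite cauchy_convC IHv.
rewrite !letter_mul_sum mulr_sumr.
have -> : shuffle (a :: u) (b :: v) = [seq a :: w | w <- shuffle u (b :: v)] ++
    [seq b :: w | w <- shuffle (a :: u) v] by [].
rewrite big_cat !big_map /=.
by congr (_ + _); rewrite big_seq [RHS]big_seq; apply: eq_bigr => w hw;
  rewrite -euler_xcoef //; apply: (@shuffle_admissible (a :: u) (b :: v)) => //;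
  rewrite mem_cat map_f ?orbT.
Qed.

End PolylogCoefficients.

(** * Homogeneous parts and the bound that characterizes the domain *)

Section HomogeneousParts.
Variable R : realType.
Local Notation C := R[i].
Implicit Types (S T : ncseries R bool) (z : C).

(** Coefficient of z^N in the polylogarithm of the component of degree n. *)
Definition part_coef S n N : C :=
  \sum_(w <- xwords n) S w * li_coef R (yword_of w) N.

(** Coefficient of z^N in the same polylogarithm divided by 1 - z. *)
Definition part_harmonic S n N : C := \sum_(0 <= k < N.+1) part_coef S n k.

Lemma part_harmonicE S n N : part_harmonic S n N =
  \sum_(w <- xwords n) S w * harmonic_sum R (yword_of w) N.+1.
Proof.
rewrite /part_harmonic exchange_big /=; apply: eq_bigr => w _.
by rewrite harmonic_sumE mulr_sumr.
Qed.

Lemma Li_partE S n z :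
  Li_part S n z = \sum_(w <- xwords n) S w * polylog (yword_of w) z.
Proof. by rewrite /Li_part /xwords big_filter big_map big_enum_cond. Qed.

Lemma Li_part_series S n z : normc z <= 4^-1 ->
  series (fun N => part_coef S n N * z ^+ N) @ \oo --> Li_part S n z.
Proof.
move=> z4; rewrite Li_partE (_ : series _ = fun M => \sum_(w <- xwords n)
    S w * series (fun N => li_coef R (yword_of w) N * z ^+ N) M).
  apply: (@cvgn_sum _ _ _ _ _ (fun w M => S w *
    series (fun N => li_coef R (yword_of w) N * z ^+ N) M)) => w _.
  exact: (cvgM (cvg_cst (S w)) (polylog_series (v := yword_of w) z4)).
apply/funext => M; rewrite /series /=; under [RHS]eq_bigr do rewrite mulr_sumr.
rewrite exchange_big /=; apply: eq_bigr => N _; rewrite mulr_suml.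
by apply: eq_bigr => w _; rewrite mulrA.
Qed.

Lemma part_coef_summable S n : exists B, forall m,
  \sum_(0 <= N < m) normc (part_coef S n N) * 4^-1 ^+ N <= B.
Proof.
exists (\sum_(w <- xwords n) normc (S w) * 2) => m.
apply: (@le_trans _ _ (\sum_(w <- xwords n) normc (S w) *
    \sum_(0 <= N < m) normc (li_coef R (yword_of w) N) * 4^-1 ^+ N)).
  under [leRHS]eq_bigr do rewrite mulr_sumr.
  rewrite [leRHS]exchange_big /=; apply: ler_sum => N _.
  under [leRHS]eq_bigr do rewrite mulrA -normcM.
  rewrite -mulr_suml ler_wpM2r ?exprn_ge0 //; exact: ler_normc_sum.
by apply: ler_sum => w _; rewrite ler_wpM2l ?normc_ge0 ?sum_li_coef_le.
Qed.

Lemma support_xwords S : admissible_series S ->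
  forall u, S u != 0 -> u \in xwords (size u).
Proof.
move=> AS u; rewrite mem_xwords eqxx andbT; apply: contraR => /AS ->.
by rewrite eqxx.
Qed.

Lemma part_coef_shuffle S T n N : admissible_series S -> admissible_series T ->
  part_coef (shuffle_series S T) n N = \sum_(0 <= i < n.+1)
    \sum_(0 <= p < N.+1) part_coef S i p * part_coef T (n - i)%N (N - p)%N.
Proof.
move=> AS AT; rewrite /part_coef /shuffle_series (sum_bilinear_ext (wt := size)
  (W := xwords) _ _ _ (fun w => li_coef R (yword_of w) N)).
- apply: eq_bigr => i _; under [RHS]eq_bigr do rewrite mulr_suml.
  rewrite [RHS]exchange_big /= big_seq [RHS]big_seq; apply: eq_bigr => u.
  rewrite mem_xwords => /andP[Au _]; under [RHS]eq_bigr do rewrite mulr_sumr.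
  rewrite [RHS]exchange_big /= big_seq [RHS]big_seq; apply: eq_bigr => v.
  rewrite mem_xwords => /andP[Av _]; rewrite -li_coef_shuffle // /cauchy_conv mulr_sumr.
  by apply: eq_bigr => p _; ring.
- exact: uniq_xwords.
- by move=> k u; rewrite mem_xwords => /andP[_ /eqP].
- move=> i j u v w; rewrite !mem_xwords => /andP[Au /eqP <-] /andP[Av /eqP <-] hw.
  by rewrite (shuffle_admissible Au Av hw) (shuffle_size hw) eqxx.
- exact: support_xwords.
- exact: support_xwords.
Qed.

Lemma sum_piX (V : ncseries R nat) (L : seq nat -> C) n :
  \sum_(w <- xwords n) piX V w * L (yword_of w) = \sum_(v <- ywords n) V v * L v.
Proof.
rewrite big_map big_seq [RHS]big_seq; apply: eq_bigr => w.
by rewrite mem_xwords /piX => /andP[-> _].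
Qed.

Lemma piXK S : admissible_series S -> piX (piY S) = S.
Proof.
move=> AS; apply/funext => w; rewrite /piX /piY.
by case: ifPn => [/yword_ofK ->|/AS].
Qed.

(** The stuffle preserves the weight, which is the length on the side of X,
    and truncated harmonic sums multiply by it. *)
Lemma part_harmonic_stuffle S T n N : admissible_series S -> admissible_series T ->
  part_harmonic (piX (stuffle_series (piY S) (piY T))) n N =
  \sum_(0 <= i < n.+1) part_harmonic S i N * part_harmonic T (n - i)%N N.
Proof.
move=> AS AT; rewrite part_harmonicE (@sum_piX _ (fun v => harmonic_sum R v N.+1)).
rewrite /stuffle_series (sum_bilinear_ext (wt := weight) (W := ywords)
  _ _ _ (fun v => harmonic_sum R v N.+1)).
- apply: eq_bigr => i _; rewrite -{2}(piXK AS) -{2}(piXK AT) !part_harmonicE.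
  rewrite !(@sum_piX _ (fun v => harmonic_sum R v N.+1)) mulr_suml.
  apply: eq_bigr => u _; rewrite mulr_sumr; apply: eq_bigr => v _.
  by rewrite -harmonic_sum_stuffle; ring.
- exact: uniq_ywords.
- by move=> k u; rewrite mem_ywords => /eqP.
- move=> i j u v w; rewrite !mem_ywords => /eqP <- /eqP <- hw.
  by rewrite /weight (stuffle_weight hw).
- by move=> u _; rewrite mem_ywords.
- by move=> u _; rewrite mem_ywords.
Qed.

(** Summability over the degrees n, with a geometric bound in the order N of
    the Taylor coefficient. Up to shrinking the radius, this characterizes the
    domain of Li among admissible series. *)
Definition coef_bounded S (rho K : R) := forall N m,
  \sum_(0 <= n < m) normc (part_coef S n N) * rho ^+ N <= K.

(** Splitting according to the signs of the real and imaginary parts bounds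
    the sum of moduli by four subsums. This is what converts unconditional
    into absolute convergence. *)
Lemma sum_normc_le (I : Type) (r : seq I) (c : I -> C) K :
    (forall P : pred I, normc (\sum_(i <- r | P i) c i) <= K) ->
  \sum_(i <- r) normc (c i) <= K *+ 4.
Proof.
move=> cK.
have half (p : C -> R) : {morph p : x y / x + y} -> p 0 = 0 ->
    (forall z, `|p z| <= normc z) -> \sum_(i <- r) `|p (c i)| <= K *+ 2.
  move=> pD p0 pz; rewrite (bigID (fun i => 0 <= p (c i))) /= mulr2n; apply: lerD.
    rewrite (eq_bigr (fun i => p (c i))) => [|i h]; last by rewrite ger0_norm.
    rewrite -(big_morph p pD p0).
    exact: le_trans (le_trans (ler_norm _) (pz _)) (cK _).
  rewrite (eq_bigr (fun i => - p (c i))) => [|i h]; last first.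
    by rewrite ltr0_norm // ltNge.
  rewrite sumrN -(big_morph p pD p0).
  apply: le_trans (le_trans (ler_norm _) _) (cK (fun i => ~~ (0 <= p (c i)))).
  by rewrite normrN.
apply: (@le_trans _ _ (\sum_(i <- r) (`|complex.Re (c i)| + `|complex.Im (c i)|))).
  by apply: ler_sum => i _; exact: normc_le_ReIm.
rewrite big_split /= -[4%N]/(2 + 2)%N mulrnDr.
apply: lerD; apply: half => //; first by move=> [? ?] [].
- exact: abs_Re_le.
- by move=> [? ?] [].
- exact: abs_Im_le.
Qed.

(** A compact set of the topology of R[i] that contains the circle of radius
    rho. *)
Lemma compact_square (rho : R) :
  compact [set x +i* y | x in `[- rho, rho] & y in `[- rho, rho]].
Proof.
pose f (p : R * R) : C := p.1 +i* p.2.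
rewrite (_ : [set _ +i* _ | _ in _ & _ in _] =
    f @` (`[- rho, rho] `*` `[- rho, rho])).
  apply: continuous_compact; last by apply: compact_setX; exact: segment_compact.
  apply: continuous_subspaceT => -[x y]; apply/cvgcP => e e0.
  have e2 : 0 < e / 2 by rewrite divr_gt0.
  have /cvgrPdist_le/(_ _ e2) hx : fst @ (x, y) --> x by exact: cvg_fst.
  have /cvgrPdist_le/(_ _ e2) hy : snd @ (x, y) --> y by exact: cvg_snd.
  apply: filterS2 hx hy => p hx hy.
  apply: le_trans (normc_le_ReIm _) _; rewrite [leRHS]splitr.
  exact: lerD.
apply/seteqP; split => [z [x hx [y hy <-]]|z [[x y] [hx hy] <-]].
  by exists (x, y).
by exists x => //; exists y.
Qed.

Lemma uniform_cvgcP (K : set C) (F : set_system (C -> C)) {FF : Filter F} g :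
  {uniform K, F --> g} <-> forall e : R, 0 < e ->
    \forall f \near F, forall z, K z -> normc (g z - f z) <= e.
Proof.
split=> [Fg e e0|Fg].
  apply: Fg; apply/uniform_nbhs; exists [set p : C * C | ball p.1 e%:C p.2]; split.
    by rewrite -entourage_ballE; exists e%:C => //=; rewrite ltcR.
  move=> h gh z Kz; have := gh z Kz.
  by rewrite /= -ball_normE /= normrcE ltcR; exact: ltW.
move=> P /uniform_nbhs[E [+ EP]]; rewrite -entourage_ballE => -[e /= e0 eE].
have er : e \is Num.real by exact: gtr0_real.
have e20 : 0 < complex.Re e / 2 by rewrite divr_gt0 // -ltcR RRe_real.
have := Fg _ e20; apply: filterS => f gf; apply: EP => z Kz; apply: eE => /=.
rewrite -ball_normE /= normrcE -(RRe_real er) ltcR.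
by apply: le_lt_trans (gf z Kz) _; lra.
Qed.

Lemma partial_sumE (f : nat -> C -> C) (J : {fset nat}) z :
  partial_sum f J z = \sum_(n <- J) f n z.
Proof. by rewrite /partial_sum fct_sumE big_seq_fsetE. Qed.

(** Past some degree n0, every finite sum of the functions Li_part S n is at
    most 2 on a fixed square: it is the difference of two partial sums that
    are within 1 of the limit. By Cauchy's estimate the same sums of
    coefficients are at most 2 / rho^N, with a constant that does not depend
    on the set of degrees, so the sums of moduli are bounded. The radius r / 4
    keeps the square of half side r / 4 inside the disc of radius r, and keeps
    all polylogarithms absolutely expandable. *)
Lemma Dom_coef_bounded S r : 0 < r <= 1 -> Dom r S ->
  exists K, coef_bounded S (r / 4) K.
Proof.
move=> /andP[r0 r1] [_ [g _ /fam_cvgP Sg]].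
set rho := r / 4; have rho0 : 0 < rho by rewrite divr_gt0.
have rho4 : rho <= 4^-1 by rewrite /rho; lra.
pose Q : set C := [set x +i* y | x in `[- rho, rho] & y in `[- rho, rho]].
have QD : Q `<=` disc r.
  move=> _ [x + [y + <-]]; rewrite /= !in_itv /= => hx hy.
  rewrite /disc /= normrcE ltcR; apply: le_lt_trans (normc_le_ReIm _) _ => /=.
  by move: hx hy; rewrite -!ler_norml /rho; lra.
have [J0 _ hJ0] : \forall J \near totally, forall z, Q z ->
    normc (g z - partial_sum (Li_part S) J z) <= 1.
  have FF : Filter (partial_sum (Li_part S) @ totally) by apply: fmap_filter; exact: totally_filter.
  have QSg := Sg FF Q (conj QD (@compact_square rho)).
  exact: (@uniform_cvgcP Q _ FF g).1 QSg 1 ltr01.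
(* Degrees from n0 on are disjoint from J0, so adding them to J0 changes the
   partial sum by exactly their sum. *)
have [n0 hn0] : exists n0, forall n, n \in J0 -> (n < n0)%N.
  exists (\max_(n <- J0) n).+1 => n nJ.
  by rewrite ltnS; exact: leq_bigmax_seq.
have QS (z : C) : normc z = rho -> Q z.
  move=> zr; exists (complex.Re z); last exists (complex.Im z); last by case: (z).
    by rewrite /= in_itv /= -ler_norml -zr abs_Re_le.
  by rewrite /= in_itv /= -ler_norml -zr abs_Im_le.
have sub2 (P : pred nat) m z : normc z = rho ->
    normc (\sum_(n0 <= n < m | P n) Li_part S n z) <= 2.
  move=> zr; pose I := [fset n in [seq n <- index_iota n0 m | P n]]%fset.
  have h0 := hJ0 J0 (fsubset_refl _) z (QS z zr).
  have h1 := hJ0 (J0 `|` I)%fset (fsubsetUl _ _) z (QS z zr).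
  have -> : \sum_(n0 <= n < m | P n) Li_part S n z =
      (g z - partial_sum (Li_part S) J0 z) -
      (g z - partial_sum (Li_part S) (J0 `|` I)%fset z).
    rewrite !partial_sumE; have -> : \sum_(n <- (J0 `|` I)%fset) Li_part S n z =
        \sum_(n <- J0) Li_part S n z + \sum_(n0 <= n < m | P n) Li_part S n z.
      transitivity (\sum_(n <- J0 ++ [seq n <- index_iota n0 m | P n]) Li_part S n z);
        last by rewrite big_cat big_filter.
      apply/perm_big/uniq_perm; rewrite ?fset_uniq //.
        rewrite cat_uniq fset_uniq filter_uniq ?iota_uniq //= andbT.
        apply/hasPn => n; rewrite mem_filter mem_index_iota => /and3P[_ n0n _].
        by apply/negP => /hn0; rewrite ltnNge n0n.
      by move=> n; rewrite mem_cat !inE.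
    by ring.
  apply: le_trans (le_normcD _ _) _; rewrite normcN; lra.
pose B n := sval (cid (part_coef_summable S n)).
have BP n m : \sum_(0 <= N < m) normc (part_coef S n N) * rho ^+ N <= B n.
  apply: le_trans (svalP (cid (part_coef_summable S n)) m).
  apply: ler_sum => N _; rewrite ler_wpM2l ?normc_ge0 //.
  by rewrite lerXn2r ?nnegrE ?(ltW rho0).
have tail N m : \sum_(n0 <= n < m) normc (part_coef S n N) * rho ^+ N <= 8.
  have -> : 8 = (2 : R) *+ 4 by ring.
  rewrite (eq_bigr (fun n => normc (part_coef S n N * rho%:C ^+ N))) => [|n _].
  apply: sum_normc_le => P; rewrite -mulr_suml normcM normcX normc_real gtr0_norm //.
  apply: (@cauchy_estimate _ (fun k => \sum_(n0 <= n < m | P n) part_coef S n k)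
    (fun z => \sum_(n0 <= n < m | P n) Li_part S n z) _ _
     (\sum_(n0 <= n < m | P n) B n)); first exact: ltW.
  - move=> k; apply: (@le_trans _ _ (\sum_(n0 <= n < m | P n)
      \sum_(0 <= N < k) normc (part_coef S n N) * rho ^+ N)).
      rewrite [leRHS]exchange_big /=; apply: ler_sum => j _.
      rewrite -mulr_suml ler_wpM2r ?exprn_ge0 ?(ltW rho0) //; exact: ler_normc_sum.
    apply: ler_sum => n _; exact: BP.
  - move=> z zr; rewrite (_ : series _ = fun M => \sum_(n0 <= n < m | P n)
      series (fun k => part_coef S n k * z ^+ k) M).
      apply: (@cvgn_sum _ _ _ _ _ (fun n => series (fun k => part_coef S n k * z ^+ k))).
      by move=> n _; apply: Li_part_series; rewrite zr.
    apply/funext => M; rewrite /series /= exchange_big /=.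
    by apply: eq_bigr => k _; rewrite mulr_suml.
  - by move=> z; exact: sub2.
  by rewrite normcM normcX normc_real gtr0_norm.
exists (\sum_(0 <= n < n0) B n + 8) => N m.
have t0 n : 0 <= normc (part_coef S n N) * rho ^+ N.
  by rewrite mulr_ge0 ?normc_ge0 ?exprn_ge0 ?(ltW rho0).
apply: (@le_trans _ _ (\sum_(0 <= n < n0 + m) normc (part_coef S n N) * rho ^+ N)).
  by rewrite [leRHS](big_cat_nat (n := m)) ?leq_addl //= lerDl sumr_ge0.
rewrite (big_cat_nat (n := n0)) ?leq_addr //=; apply: lerD (tail _ _).
apply: ler_sum => n _; apply: le_trans (BP n N.+1).
by rewrite big_nat_recr //= lerDr sumr_ge0 // => k _;
  rewrite mulr_ge0 ?normc_ge0 ?exprn_ge0 ?(ltW rho0).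
Qed.

End HomogeneousParts.

(** * Taylor coefficients of the whole series *)

Section TotalCoefficients.
Variable R : realType.
Local Notation C := R[i].
Implicit Types (S T : ncseries R bool) (z : C).

(** The N-th Taylor coefficient of Li S, as a sum over the degrees. *)
Definition total_coef S N : C := limn (series (fun n => part_coef S n N)).

(** The N-th Taylor coefficient of Li S z / (1 - z). *)
Definition total_harmonic S N : C := \sum_(0 <= k < N.+1) total_coef S k.

Lemma coef_bounded_le S (rho rho' K : R) : 0 < rho' <= rho ->
  coef_bounded S rho K -> coef_bounded S rho' K.
Proof.
move=> /andP[r'0 r'r] SK N m; apply: le_trans (SK N m); apply: ler_sum => n _.
by rewrite ler_wpM2l ?normc_ge0 // lerXn2r ?nnegrE ?(ltW r'0) // ltW // (lt_le_trans r'0).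
Qed.

Section Bounded.
Variables (S : ncseries R bool) (rho K : R).
Hypotheses (rho0 : 0 < rho) (rho1 : rho <= 1) (SK : coef_bounded S rho K).

Lemma coef_bounded_ge0 : 0 <= K.
Proof. by have := SK 0%N 0%N; rewrite big_geq. Qed.

Lemma sum_part_coef_le N m :
  \sum_(0 <= n < m) normc (part_coef S n N) <= K / rho ^+ N.
Proof. by rewrite ler_pdivlMr ?exprn_gt0 // mulr_suml; exact: SK. Qed.

Lemma total_coefP N : series (fun n => part_coef S n N) @ \oo --> total_coef S N.
Proof.
have [l hl] := abs_series_cvg (sum_part_coef_le N).
by rewrite /total_coef (cvg_lim _ hl).
Qed.

Lemma total_coef_le N : normc (total_coef S N) * rho ^+ N <= K.
Proof.
rewrite -ler_pdivlMr ?exprn_gt0 //.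
exact: abs_series_le (@total_coefP N) (sum_part_coef_le N).
Qed.

Lemma expr_lt_quarter z N : normc z < rho / 4 -> normc z ^+ N <= (rho / 2) ^+ N.
Proof.
move=> zr; rewrite lerXn2r ?nnegrE ?normc_ge0 ?divr_ge0 ?(ltW rho0) //.
by apply: le_trans (ltW zr) _; move: rho0; lra.
Qed.

Lemma total_coef_summable z : normc z < rho / 4 -> forall M,
  \sum_(0 <= N < M) normc (total_coef S N * z ^+ N) <= K * 2.
Proof.
move=> zr M; apply: le_trans (sum_geometric_le (b := fun N => normc (total_coef S N))
  M rho0 _ total_coef_le); last by move=> k; exact: normc_ge0.
by apply: ler_sum => N _; rewrite normcM normcX ler_wpM2l ?normc_ge0 ?expr_lt_quarter.
Qed.

(** The array with entries part_coef S n N * z^N is dominated by the geometric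
    series K 2^-N, so summing it by degrees or by powers of z gives the same
    result. *)
Lemma Li_series z : normc z < rho / 4 ->
  series (fun n => Li_part S n z) @ \oo --> Li S z /\
  series (fun N => total_coef S N * z ^+ N) @ \oo --> Li S z.
Proof.
move=> zr; have [||||l [Sl Al]] := @double_series _
  (fun n N => part_coef S n N * z ^+ N) (fun n => Li_part S n z)
  (fun N => total_coef S N * z ^+ N) (fun N => K / rho ^+ N * (rho / 2) ^+ N) (K * 2).
- by move=> n; apply: Li_part_series; move: rho0 rho1; lra.
- move=> N; rewrite (_ : series _ = fun m => series (fun n => part_coef S n N) m * z ^+ N).
    exact: (cvgM (@total_coefP N) (cvg_cst _)).
  by apply/funext => m; rewrite /series /= mulr_suml.
- move=> N m; under eq_bigr do rewrite normcM normcX.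
  rewrite -mulr_suml ler_pM ?sumr_ge0 ?exprn_ge0 ?normc_ge0 ?sum_part_coef_le
    ?expr_lt_quarter // => n _; exact: normc_ge0.
- move=> M; apply: sum_geometric_le => // k.
    by rewrite divr_ge0 ?coef_bounded_ge0 ?exprn_ge0 ?(ltW rho0).
  by rewrite divfK ?expf_neq0 ?gt_eqF.
by rewrite /Li (cvg_lim _ Sl).
Qed.

(** A summable majorant of the homogeneous parts, uniform on a whole disc; it
    makes every net of finite partial sums converge uniformly there. *)
Lemma Li_part_majorant : exists2 t : nat -> R,
  (forall z n, normc z < rho / 4 -> normc (Li_part S n z) <= t n) &
  forall m, \sum_(0 <= n < m) t n <= K * 2.
Proof.
pose c n N := normc (part_coef S n N) * (rho / 2) ^+ N.
have c0 n N : 0 <= c n N.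
  by rewrite mulr_ge0 ?normc_ge0 ?exprn_ge0 ?divr_ge0 ?(ltW rho0).
have csum m M : \sum_(0 <= N < M) \sum_(0 <= n < m) c n N <= K * 2.
  under eq_bigr do rewrite -mulr_suml.
  apply: sum_geometric_le => // k; first by rewrite sumr_ge0 // => n _; exact: normc_ge0.
  by rewrite mulr_suml; exact: SK.
have cn n M : \sum_(0 <= N < M) c n N <= K * 2.
  apply: le_trans (csum n.+1 M); apply: ler_sum => N _.
  by rewrite [leRHS]big_nat_recr //= lerDr sumr_ge0.
have nd n : nondecreasing_seq (series (c n)).
  by apply: nondecreasing_series => N _ _; exact: c0.
have cv n : cvgn (series (c n)).
  by apply: nondecreasing_is_cvgn => //; exists (K * 2) => _ [M _ <-]; exact: cn.
exists (fun n => limn (series (c n))) => [z n zr|m].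
  have z4 : normc z <= 4^-1 by move: rho0 rho1; lra.
  have h := @Li_part_series _ S n z z4.
  apply: (abs_series_le h) => M /=.
  apply: le_trans (nondecreasing_cvgn_le (nd n) (cv n) M); apply: ler_sum => N _.
  by rewrite normcM normcX ler_wpM2l ?normc_ge0 ?expr_lt_quarter.
have := @cvgn_sum _ _ _ (index_iota 0 m) xpredT (fun n => series (c n)) _ (fun n _ => cv n).
move=> h; rewrite -(cvg_lim _ h) //; apply: limr_le; first exact: cvgP h.
by near=> M; rewrite /series /= exchange_big /=.
Unshelve. all: by end_near.
Qed.

(** The radius is divided by 4 for the double series and by 8 for termwise
    differentiation. Convergence is uniform on the whole disc, hence on its
    compact subsets. *)
Lemma coef_bounded_Dom : admissible_series S -> Dom (rho / 32) S.
Proof.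
move=> AS; split => //; exists (Li S).
  move=> z; rewrite /disc /= normrcE ltcR => zr.
  apply: (@power_series_derivable _ (total_coef S) _ (rho / 4) K); rewrite ?divr_gt0 //.
  - move=> N; apply: le_trans (total_coef_le N); rewrite ler_wpM2l ?normc_ge0 //.
    by rewrite lerXn2r ?nnegrE ?divr_ge0 ?(ltW rho0) //; move: rho0 rho1; lra.
  - by move=> x xr; exact: (Li_series xr).2.
  by move: rho0 rho1; lra.
have FF : Filter (partial_sum (Li_part S) @ totally).
  by apply: fmap_filter; exact: totally_filter.
apply/fam_cvgP => Q [QD _]; apply/(@uniform_cvgcP _ Q _ FF) => e e0.
have [t Lt tK] := Li_part_majorant.
have disc0 : normc (0 : C) < rho / 4 by rewrite normc0 divr_gt0.
have t0 n : 0 <= t n by apply: le_trans (Lt 0 n disc0); exact: normc_ge0.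
have [n0 hn0] := small_tail t0 tK e0.
exists [fset n in iota 0 n0]%fset => // J /= /fsubsetP J0J z Qz.
have zr : normc z < rho / 4.
  by have := QD z Qz; rewrite /disc /= normrcE ltcR; move: rho0 rho1; lra.
rewrite partial_sumE.
have cJ : (fun m => series (fun n => Li_part S n z) m - \sum_(n <- J) Li_part S n z)
    @ \oo --> Li S z - \sum_(n <- J) Li_part S n z.
  by apply: cvgB; [exact: (Li_series zr).1|exact: cvg_cst].
apply: (cvgc_normc_le cJ); exists (\max_(n <- J) n).+1 => // m /= Jm.
have -> : \sum_(n <- J) Li_part S n z = \sum_(0 <= n < m | n \in J) Li_part S n z.
  rewrite -[RHS]big_filter; apply/perm_big/uniq_perm; rewrite ?fset_uniq ?filter_uniq ?iota_uniq //.
  move=> n; rewrite mem_filter mem_index_iota /=; case: (boolP (n \in J)) => //= nJ.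
  by apply/esym/(leq_trans _ Jm); rewrite ltnS; exact: leq_bigmax_seq.
rewrite /series /= [X in X - _](bigID (fun n => n \in J)) /= addrAC subrr add0r.
apply: le_trans (ler_normc_sum _ _ _) _.
apply: (@le_trans _ _ (\sum_(n0 <= n < m) t n)); last exact: hn0.
apply: (@le_trans _ _ (\sum_(0 <= n < m | n \notin J) t n)).
  by apply: ler_sum => n _; exact: Lt.
have [mn|/ltnW nm] := leqP m n0.
  rewrite big_nat_cond big1 ?sumr_ge0 // => n /andP[/andP[_ nm] /negP[]].
  by apply: J0J; rewrite !inE mem_iota /= (leq_trans nm).
rewrite (big_cat_nat (n := n0)) //= [X in X + _]big_nat_cond big1 ?add0r.
  by rewrite big_mkcond; apply: ler_sum => n _; case: ifP.
by move=> n /andP[/andP[_ nn] /negP[]]; apply: J0J; rewrite !inE mem_iota.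
Qed.

(** The sum l exists by absolute convergence and satisfies l = 1 + z l. *)
Lemma geometric_expansion z : normc z < 2^-1 ->
  series (fun N => z ^+ N) @ \oo --> (1 - z)^-1.
Proof.
move=> z2; have [l hl] : exists l : C, series (fun N => z ^+ N) @ \oo --> l.
  apply: (@abs_series_cvg _ _ 2) => n; apply: le_trans (sum_half_le R n).
  apply: ler_sum => N _; rewrite normcX.
  by rewrite lerXn2r ?nnegrE ?normc_ge0 ?invr_ge0 ?(ltW z2).
have hl' : (fun n => 1 + z * series (fun N => z ^+ N) n) @ \oo --> 1 + z * l.
  by apply: cvgD; [exact: cvg_cst|exact: (cvgM (cvg_cst z) hl)].
have : series (fun N => z ^+ N) @ \oo --> 1 + z * l.
  rewrite -(cvg_shiftS (series _)); rewrite (_ : (fun n => _) = fun n =>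
    1 + z * series (fun N => z ^+ N) n) //.
  apply/funext => n; rewrite /series /= big_nat_recl // expr0 mulr_sumr.
  by congr (_ + _); apply: eq_bigr => N _; rewrite exprS.
move=> /(cvgn_unique hl) lE; have z1 : 1 - z != 0.
  by apply/eqP => /subr0_eq z1; move: z2; rewrite -z1 normc1; lra.
by rewrite (_ : (1 - z)^-1 = l) //; apply: (mulfI z1); rewrite divff // mulrBl mul1r {1}lE addrK.
Qed.

(** Cauchy product of the expansion of Li S with the geometric series. *)
Lemma has_expansion_harmonic :
  has_expansion (fun z => Li S z / (1 - z)) (total_harmonic S).
Proof.
apply/near0P; exists (rho / 4); first by rewrite divr_gt0.
move=> z zr; have z2 : normc z < 2^-1 by move: rho0 rho1; lra.
have := @cauchy_product _ _ _ _ _ (K * 2) 2 (Li_series zr).2 (geometric_expansion z2)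
  (total_coef_summable zr) _.
rewrite (_ : (fun n => \sum_(0 <= k < n.+1) _) = fun N => total_harmonic S N * z ^+ N).
  apply=> n; apply: le_trans (sum_half_le R n); apply: ler_sum => N _; rewrite normcX.
  by rewrite lerXn2r ?nnegrE ?normc_ge0 ?invr_ge0 ?(ltW z2).
apply/funext => N; rewrite /total_harmonic mulr_suml big_nat [RHS]big_nat.
apply: eq_bigr => k /andP[_]; rewrite ltnS => kN.
by rewrite -mulrA -exprD subnKC.
Qed.

(** Summing the bounds K / rho^k over k <= N costs a factor N + 1, which
    halving the radius absorbs. *)
Lemma sum_part_harmonic_le N m :
  \sum_(0 <= n < m) normc (part_harmonic S n N) * (rho / 2) ^+ N <= K.
Proof.
apply: (@le_trans _ _ (\sum_(0 <= k < N.+1) \sum_(0 <= n < m)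
    normc (part_coef S n k) * rho ^+ k * 2^-1 ^+ N)).
  rewrite exchange_big /=; apply: ler_sum => n _.
  apply: le_trans (ler_wpM2r _ (ler_normc_sum _ _ _)) _.
    by rewrite exprn_ge0 ?divr_ge0 ?(ltW rho0).
  rewrite mulr_suml; apply: ler_sum_nat => k /andP[_]; rewrite ltnS => kN.
  rewrite exprMn mulrA ler_wpM2r ?exprn_ge0 // ler_wpM2l ?normc_ge0 //.
  by rewrite ler_wiXn2l ?(ltW rho0).
apply: (@le_trans _ _ (\sum_(0 <= k < N.+1) K * 2^-1 ^+ N)).
  by apply: ler_sum => k _; rewrite -mulr_suml ler_wpM2r ?exprn_ge0.
rewrite sumr_const_nat subn0 -[leRHS]mulr1 -mulrnAr ler_wpM2l ?coef_bounded_ge0 //.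
rewrite -mulr_natr exprVn mulrC ler_pdivrMr ?exprn_gt0 // mul1r.
by rewrite -natrX ler_nat ltn_expl.
Qed.

Lemma total_harmonicP N :
  series (fun n => part_harmonic S n N) @ \oo --> total_harmonic S N.
Proof.
rewrite (_ : series _ = fun m => \sum_(0 <= k < N.+1) series (fun n => part_coef S n k) m).
  apply: (@cvgn_sum _ _ _ _ _ (fun k => series (fun n => part_coef S n k))) => k _.
  exact: total_coefP.
by apply/funext => m; rewrite /series /= exchange_big.
Qed.

End Bounded.

Lemma has_expansion_taylor_coef (f : C -> C) a : has_expansion f a -> taylor_coef f = a.
Proof.
move=> fa; apply: (expansion_unique (f := f)) => //.
exact: (@xgetPex _ (fun=> 0) [set a | has_expansion f a] (ex_intro _ a fa)).
Qed.

Lemma conv_sum_le (u v : nat -> R) m : (forall n, 0 <= u n) -> (forall n, 0 <= v n) ->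
  \sum_(0 <= n < m) \sum_(0 <= i < n.+1) u i * v (n - i)%N <=
  (\sum_(0 <= n < m) u n) * (\sum_(0 <= n < m) v n).
Proof.
move=> u0 v0.
rewrite (_ : \sum_(0 <= n < m) _ = \sum_(0 <= n < m) \sum_(0 <= i < m)
    u i * (if (i <= n)%N then v (n - i)%N else 0)).
  rewrite exchange_big /= mulr_suml; apply: ler_sum_nat => i /andP[_ im].
  rewrite -mulr_sumr ler_wpM2l // sum_shift ?(ltnW im) //.
  by rewrite [leRHS](big_cat_nat (n := (m - i)%N)) ?leq_subr //= lerDl sumr_ge0.
rewrite big_nat [RHS]big_nat; apply: eq_bigr => n /andP[_ nm].
rewrite [RHS](big_cat_nat (n := n.+1)) //= [X in _ = _ + X]big_nat.
rewrite [X in _ = _ + X]big1 ?addr0 => [|i /andP[ni _]]; last first.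
  by rewrite leqNgt ni mulr0.
rewrite big_nat [RHS]big_nat; apply: eq_bigr => i /andP[_].
by rewrite ltnS => ->.
Qed.

End TotalCoefficients.

(** * Shuffle and stuffle of two series *)

Section Products.
Variable R : realType.
Local Notation C := R[i].
Implicit Types (S T : ncseries R bool) (z : C) (rho : R).

Lemma shuffle_series_admissible S T : admissible_series S -> admissible_series T ->
  admissible_series (shuffle_series S T).
Proof.
move=> AS AT w Aw; apply: fsbig1 => -[u v] _ /=; apply/eqP.
apply: contraNT Aw; rewrite !mulf_eq0 !negb_or pnatr_eq0 -lt0n => /andP[/andP[Su Tv]].
rewrite -has_count => /hasP[w' uvw /eqP w'w].
rewrite w'w in uvw; apply: shuffle_admissible uvw.
  by apply: contraNT Su => /AS ->.
by apply: contraNT Tv => /AT ->.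
Qed.

Lemma piX_admissible (V : ncseries R nat) : admissible_series (piX V).
Proof. by move=> w /negbTE Aw; rewrite /piX Aw. Qed.

Lemma Dom_loc_coef_bounded S : Dom_loc S -> admissible_series S /\
  exists rho K, [/\ 0 < rho, rho <= 1 & coef_bounded S rho K].
Proof.
move=> [r [r01 DS]]; split; first by case: DS.
have [K SK] := Dom_coef_bounded r01 DS; exists (r / 4), K.
have [r0 r1] := andP r01.
by split=> //; [rewrite divr_gt0|lra].
Qed.

Lemma coef_bounded_Dom_loc S rho K : admissible_series S -> 0 < rho -> rho <= 1 ->
  coef_bounded S rho K -> Dom_loc S.
Proof.
move=> AS rho0 rho1 SK; exists (rho / 32); split; last exact: coef_bounded_Dom SK AS.
by rewrite divr_gt0 //=; lra.
Qed.

Section BoundedPair.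
Variables (S T : ncseries R bool) (rho KS KT : R).
Hypotheses (AS : admissible_series S) (AT : admissible_series T).
Hypotheses (rho0 : 0 < rho) (rho1 : rho <= 1).
Hypotheses (SK : coef_bounded S rho KS) (TK : coef_bounded T rho KT).

Let stuffle_ST := piX (stuffle_series (piY S) (piY T)).

(** The product of the two bounds, with a factor N + 1 for the pairs p + q =
    N; halving the radius absorbs it. *)
Lemma shuffle_coef_bounded : coef_bounded (shuffle_series S T) (rho / 2) (KS * KT).
Proof.
move=> N m; have KS0 := coef_bounded_ge0 SK; have KT0 := coef_bounded_ge0 TK.
have step p : (p <= N)%N -> \sum_(0 <= n < m) \sum_(0 <= i < n.+1)
    normc (part_coef S i p) * normc (part_coef T (n - i)%N (N - p)%N) <=
    KS * KT / rho ^+ N.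
  move=> pN; apply: le_trans (@conv_sum_le _ (fun i => normc (part_coef S i p))
    (fun j => normc (part_coef T j (N - p)%N)) m (fun=> normc_ge0 _)
    (fun=> normc_ge0 _)) _.
  rewrite -[in leRHS](subnKC pN) exprD invfM mulrACA.
  by apply: ler_pM; rewrite ?sumr_ge0 ?sum_part_coef_le // => n _; exact: normc_ge0.
apply: (@le_trans _ _ (\sum_(0 <= p < N.+1) KS * KT / rho ^+ N * (rho / 2) ^+ N)).
  rewrite -mulr_suml -[leRHS]mulr_suml ler_wpM2r ?exprn_ge0 ?divr_ge0 ?(ltW rho0) //.
  apply: (@le_trans _ _ (\sum_(0 <= p < N.+1) \sum_(0 <= n < m) \sum_(0 <= i < n.+1)
      normc (part_coef S i p) * normc (part_coef T (n - i)%N (N - p)%N))).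
    rewrite exchange_big /=; apply: ler_sum => n _; rewrite part_coef_shuffle //.
    rewrite [leRHS]exchange_big /=.
    apply: le_trans (ler_normc_sum _ _ _) _; apply: ler_sum => i _.
    apply: le_trans (ler_normc_sum _ _ _) _; apply: ler_sum => p _.
    by rewrite normcM.
  by apply: ler_sum_nat => p /andP[_ pN]; apply: step.
rewrite exprMn mulrA divfK ?expf_neq0 ?gt_eqF // sumr_const_nat subn0.
rewrite -[leRHS]mulr1 -mulrnAr ler_wpM2l ?mulr_ge0 //.
rewrite -mulr_natr exprVn mulrC ler_pdivrMr ?exprn_gt0 // mul1r.
by rewrite -natrX ler_nat ltn_expl.
Qed.

Lemma total_coef_shuffle N : total_coef (shuffle_series S T) N =
  cauchy_conv (total_coef S) (total_coef T) N.
Proof.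
have half0 : 0 < rho / 2 by rewrite divr_gt0.
apply: (cvgn_unique (@total_coefP _ _ _ _ half0 shuffle_coef_bounded N)).
rewrite (_ : series _ = fun m => \sum_(0 <= p < N.+1) series (fun n =>
    \sum_(0 <= i < n.+1) part_coef S i p * part_coef T (n - i)%N (N - p)%N) m).
  apply: (@cvgn_sum _ _ _ _ _ (fun p => series (fun n =>
    \sum_(0 <= i < n.+1) part_coef S i p * part_coef T (n - i)%N (N - p)%N))
    (fun p => total_coef S p * total_coef T (N - p)%N)) => p _.
  exact: cauchy_product (@total_coefP _ _ _ _ rho0 SK p)
    (@total_coefP _ _ _ _ rho0 TK (N - p)%N)
    (sum_part_coef_le rho0 SK p) (sum_part_coef_le rho0 TK (N - p)%N).
apply/funext => m; rewrite /series /= [RHS]exchange_big /=; apply: eq_bigr => n _.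
by rewrite (part_coef_shuffle n N AS AT) exchange_big.
Qed.

(** The coefficient of z^N of both sides is the Cauchy product of total
    coefficients. *)
Lemma Li_shuffle z : normc z < rho / 8 ->
  Li (shuffle_series S T) z = Li S z * Li T z.
Proof.
move=> z8; have half0 : 0 < rho / 2 by rewrite divr_gt0.
have half1 : rho / 2 <= 1 by move: rho0 rho1; lra.
have zr : normc z < rho / 4 by move: rho0; lra.
have zr' : normc z < rho / 2 / 4 by move: rho0; lra.
apply: (cvgn_unique (Li_series half0 half1 shuffle_coef_bounded zr').2).
have := cauchy_product (Li_series rho0 rho1 SK zr).2 (Li_series rho0 rho1 TK zr).2
  (total_coef_summable rho0 SK zr) (total_coef_summable rho0 TK zr).
rewrite (_ : (fun n => _) = fun N => total_coef (shuffle_series S T) N * z ^+ N) //.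
apply/funext => N; rewrite total_coef_shuffle mulr_suml.
apply: eq_big_nat => k /andP[_]; rewrite ltnS => kN.
have -> : z ^+ N = z ^+ k * z ^+ (N - k)%N by rewrite -exprD subnKC.
exact: mulrACA.
Qed.

(** The partial sums of Taylor coefficients multiply at equal N, so the radii
    multiply as well: (rho / 2)^2. Going back to coefficients takes a
    difference of two consecutive partial sums, whence the factor 2. *)
Lemma stuffle_coef_bounded :
  coef_bounded stuffle_ST ((rho / 2) ^+ 2) (KS * KT *+ 2).
Proof.
have KS0 := coef_bounded_ge0 SK; have KT0 := coef_bounded_ge0 TK.
set r := (rho / 2) ^+ 2; have r0 : 0 < r by rewrite exprn_gt0 ?divr_gt0.
have r1 : r <= 1 by rewrite expr_le1 ?divr_ge0 ?(ltW rho0) //; move: rho0 rho1; lra.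
have harm N m : \sum_(0 <= n < m) normc (part_harmonic stuffle_ST n N) * r ^+ N <= KS * KT.
  apply: (@le_trans _ _ ((\sum_(0 <= n < m) normc (part_harmonic S n N) * (rho / 2) ^+ N) *
     (\sum_(0 <= n < m) normc (part_harmonic T n N) * (rho / 2) ^+ N))).
    have rE : (rho / 2) ^+ N * (rho / 2) ^+ N = r ^+ N.
      by rewrite /r -expr2 -!exprM mulnC.
    rewrite -[leLHS]mulr_suml -[X in _ <= X * _]mulr_suml -[X in _ <= _ * X]mulr_suml.
    rewrite mulrACA rE (ler_wpM2r (exprn_ge0 N (ltW r0))) //.
    apply: (le_trans _ (@conv_sum_le _ (fun i => normc (part_harmonic S i N))
      (fun j => normc (part_harmonic T j N)) m (fun=> normc_ge0 _)
      (fun=> normc_ge0 _))).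
    apply: ler_sum => n _; rewrite part_harmonic_stuffle //.
    by apply: le_trans (ler_normc_sum _ _ _) _; apply: ler_sum => i _; rewrite normcM.
  have pos U : 0 <= \sum_(0 <= n < m) normc (part_harmonic U n N) * (rho / 2) ^+ N.
    by rewrite sumr_ge0 // => n _; rewrite mulr_ge0 ?normc_ge0 ?exprn_ge0 ?divr_ge0 ?(ltW rho0).
  by apply: ler_pM => //; exact: sum_part_harmonic_le.
move=> [|N] m.
  apply: le_trans (_ : KS * KT <= _); last by rewrite mulr2n lerDl mulr_ge0.
  apply: le_trans (harm 0%N m); apply: ler_sum => n _.
  by rewrite /part_harmonic big_nat1.
apply: (@le_trans _ _ (\sum_(0 <= n < m) (normc (part_harmonic stuffle_ST n N.+1) * r ^+ N.+1 +
    normc (part_harmonic stuffle_ST n N) * r ^+ N))).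
  apply: ler_sum => n _; have -> : part_coef stuffle_ST n N.+1 =
      part_harmonic stuffle_ST n N.+1 - part_harmonic stuffle_ST n N.
    by rewrite /part_harmonic [X in X - _]big_nat_recr //= addrAC subrr add0r.
  apply: le_trans (ler_wpM2r _ (le_normcD _ _)) _; first by rewrite exprn_ge0 ?(ltW r0).
  rewrite normcN mulrDl lerD2l ler_wpM2l ?normc_ge0 //.
  by rewrite exprS; exact: ler_piMl (exprn_ge0 N (ltW r0)) r1.
by rewrite big_split /= mulr2n lerD.
Qed.

(** For fixed N, a Cauchy product over the degrees n. *)
Lemma total_harmonic_stuffle N :
  total_harmonic stuffle_ST N = total_harmonic S N * total_harmonic T N.
Proof.
have r0 : 0 < (rho / 2) ^+ 2 by rewrite exprn_gt0 ?divr_gt0.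
apply: (cvgn_unique (@total_harmonicP _ _ _ _ r0 stuffle_coef_bounded N)).
rewrite (_ : (fun n => _) = fun n => \sum_(0 <= i < n.+1)
    part_harmonic S i N * part_harmonic T (n - i)%N N); last first.
  by apply/funext => n; rewrite part_harmonic_stuffle.
have bound U K : coef_bounded U rho K -> forall m,
    \sum_(0 <= n < m) normc (part_harmonic U n N) <= K / (rho / 2) ^+ N.
  move=> UK m; rewrite ler_pdivlMr ?exprn_gt0 ?divr_gt0 // mulr_suml.
  exact: sum_part_harmonic_le.
exact: cauchy_product (@total_harmonicP _ _ _ _ rho0 SK N)
  (@total_harmonicP _ _ _ _ rho0 TK N) (bound _ _ SK) (bound _ _ TK).
Qed.

End BoundedPair.

(** H is defined from an expansion of Li (piX V) z / (1 - z); by uniqueness it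
    may be read off the one above. *)
Lemma H_total_harmonic (V : ncseries R nat) rho K : 0 < rho -> rho <= 1 ->
  coef_bounded (piX V) rho K -> H V = total_harmonic (piX V).
Proof.
move=> rho0 rho1 VK; apply/funext => N; rewrite /H.
by rewrite (has_expansion_taylor_coef (has_expansion_harmonic rho0 rho1 VK)).
Qed.

Lemma Li_one_series z : Li (one_series R) z = 1.
Proof.
have part n : Li_part (one_series R) n z = (n == 0)%:R.
  rewrite Li_partE; case: n => [|n].
    rewrite (bigD1_seq [::]) ?uniq_xwords ?mem_xwords //= /one_series eqxx mul1r.
    by rewrite big1 ?addr0 // => w /negbTE ->; rewrite mul0r.
  rewrite big_seq big1 // => w; rewrite mem_xwords => /andP[_ /eqP sw].
  by rewrite /one_series; case: w sw => //= a w _; rewrite mul0r.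
apply: cvg_lim => //; apply: cvg_near_cst; exists 1%N => // n /= n0.
by rewrite /series /= big_ltn // part big_nat big1 ?addr0 // => -[|k].
Qed.

End Products.

Theorem theorem2p8 (R : realType) (S T : ncseries R bool)
    (hS : Dom_loc S) (hT : Dom_loc T) :
  Dom_loc (shuffle_series S T) /\
  Dom_loc (piX (stuffle_series (piY S) (piY T))) /\
  (\forall z \near (0 : R[i]), Li (shuffle_series S T) z = Li S z * Li T z) /\
  (\forall z \near (0 : R[i]), Li (one_series R) z = 1) /\
  (forall N : nat,
     H (stuffle_series (piY S) (piY T)) N = H (piY S) N * H (piY T) N) /\
  is_hadamard (fun z : R[i] => Li S z / (1 - z))
              (fun z : R[i] => Li T z / (1 - z))
              (fun z : R[i] =>
                 Li (piX (stuffle_series (piY S) (piY T))) z / (1 - z)).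
Proof.
have [AS [rS [KS [rS0 rS1 SKS]]]] := Dom_loc_coef_bounded hS.
have [AT [rT [KT [rT0 rT1 TKT]]]] := Dom_loc_coef_bounded hT.
pose rho := Num.min rS rT.
have rho0 : 0 < rho by rewrite lt_min rS0 rT0.
have rho1 : rho <= 1 by rewrite ge_min rS1.
have SK : coef_bounded S rho KS.
  by apply: coef_bounded_le SKS; rewrite rho0 ge_min lexx.
have TK : coef_bounded T rho KT.
  by apply: coef_bounded_le TKT; rewrite rho0 ge_min lexx orbT.
set V := stuffle_series (piY S) (piY T).
have r0 : 0 < (rho / 2) ^+ 2 by rewrite exprn_gt0 ?divr_gt0.
have r1 : (rho / 2) ^+ 2 <= 1 by rewrite expr_le1 ?divr_ge0 ?(ltW rho0) //; lra.
have VK := stuffle_coef_bounded AS AT rho0 rho1 SK TK.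
have half0 : 0 < rho / 2 by rewrite divr_gt0.
have half1 : rho / 2 <= 1 by lra.
have HE : H V = fun N => total_harmonic S N * total_harmonic T N.
  rewrite (H_total_harmonic r0 r1 VK); apply/funext => N.
  exact: total_harmonic_stuffle AS AT rho0 rho1 SK TK N.
split; [|split; [|split; [|split; [|split]]]].
- apply: coef_bounded_Dom_loc half0 half1 (shuffle_coef_bounded AS AT rho0 SK TK).
  exact: shuffle_series_admissible.
- exact: coef_bounded_Dom_loc (@piX_admissible _ V) r0 r1 VK.
- apply/near0P; exists (rho / 8); first by rewrite divr_gt0.
  by move=> z; exact: Li_shuffle AS AT rho0 rho1 SK TK z.
- by apply/near0P; exists 1 => // z _; exact: Li_one_series.
- move=> N; rewrite HE (@H_total_harmonic _ (piY S) rho KS) ?piXK //.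
  by rewrite (@H_total_harmonic _ (piY T) rho KT) ?piXK.
exists (total_harmonic S), (total_harmonic T); split.
- exact: has_expansion_harmonic rho0 rho1 SK.
- exact: has_expansion_harmonic rho0 rho1 TK.
rewrite -HE (H_total_harmonic r0 r1 VK).
exact: has_expansion_harmonic r0 r1 VK.
Qed.
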